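(* Let $Q$ be a class of functions satisfying requirements I, II, III and V below. Then there exist two permutations in $\mathrm{Gr}(Q)$ such that every permutation in $\mathrm{Gr}(Q)$ is a composition of these two permutations. Requirements: (I) $Q$ contains the functions $1$, $x+y$, $x\dot- y$, $x\cdot\mathrm{sg}\,y$, $[x/2]$. (II) $Q$ contains a function $c_2(x_1,x_2)$ mapping $\mathbb{N}_0^2$ bijectively onto $\mathbb{N}_0$, together with its inverse functions $c_{2,1}(x),c_{2,2}(x)$ (i.e. $c_{2,1}(c_2(x,y))=x$, $c_{2,2}(c_2(x,y))=y$ for all $x,y$). (III) For every permutation $f\in\mathrm{Gr}(Q)$ there exist disjoint sets $A,B$, both regular in $Q$, with $f(A)\cap B=\varnothing$ and such that $\mathbb{N}_0\setminus A$ and $\mathbb{N}_0\setminus B$ are regular in $Q$. (V) $Q$ has a finite basis with respect to superposition.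
   Context: All functions are total functions on $\mathbb{N}_0$; a permutation means a bijection $\mathbb{N}_0\to\mathbb{N}_0$. Superposition means substitution of functions into functions, permutation and identification of variables, introduction of dummy variables. A finite set $\Phi$ is a finite basis with respect to superposition in $Q$ if the closure of $\Phi$ under superposition equals $Q$. $x\dot- y=\max(x-y,0)$; $\mathrm{sg}(x)=1$ if $x>0$ and $0$ otherwise; $[x/2]$ is the integer part of $x/2$. For a class $Q$ closed under superposition and containing the identity function, $\mathrm{Gr}(Q)$ is the group, under composition, of all permutations $f$ with $f\in Q$ and $f^{-1}\in Q$. An infinite set $A\subseteq\mathbb{N}_0$ is regular in $Q$ if its characteristic function $\chi_A$ lies in $Q$ and the elements of $A$ can be enumerated (starting from number $0$) so that both the function $\mu(x)$ giving the number of $x$ in this enumeration (with $\mu(x)=0$ for $x\notin A$) and the function $\nu(x)$ giving the element with number $x$ belong to $Q$. *)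

(* Defs.v *)
From mathcomp Require Import all_boot all_classical.

Set Implicit Arguments.
Unset Strict Implicit.
Unset Printing Implicit Defensive.

Local Open Scope classical_set_scope.

Definition nfun (n : nat) : Type := n.-tuple nat -> nat.

(* A class of functions is a [set mvfun]. Arity 0 is allowed; classes of
   functions of positive arity are the sets without nullary members. *)
Definition mvfun : Type := {n : nat & nfun n}.

Definition pack (n : nat) (f : nfun n) : mvfun := Tagged nfun f.

Definition fun1 (f : nat -> nat) : mvfun :=
  @pack 1 (fun x => f (tnth x ord0)).

Definition fun2 (f : nat -> nat -> nat) : mvfun :=
  @pack 2 (fun x => f (tnth x ord0) (tnth x ord_max)).

Definition proj (n : nat) (j : 'I_n) : nfun n := fun x => tnth x j.

Definition substitute (n m : nat) (f : nfun n) (g : 'I_n -> nfun m) : nfun m :=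
  fun x => f [tuple g i x | i < n].

(* Each argument of f is replaced by a member of the class or by a variable.
   When all of them are variables this is permutation and identification of
   variables and introduction of dummy variables. The projections themselves
   are not required to belong to the class. *)
Definition superposition_closed (P : set mvfun) : Prop :=
  forall (n m : nat) (f : nfun n) (g : 'I_n -> nfun m),
    P (pack f) ->
    (forall i : 'I_n, P (pack (g i)) \/ exists j : 'I_m, g i = proj j) ->
    P (pack (substitute f g)).

Definition superposition_closure (Phi : set mvfun) : set mvfun :=
  smallest superposition_closed Phi.

Definition has_finite_basis (Q : set mvfun) : Prop :=
  exists Phi : set mvfun, finite_set Phi /\ superposition_closure Phi = Q.

Definition sg (x : nat) : nat := if 0 < x then 1 else 0.

Definition contains_basic_functions (Q : set mvfun) : Prop :=
  [/\ Q (fun1 (fun _ => 1)),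
      Q (fun2 (fun x y => x + y)),
      Q (fun2 (fun x y => x - y)),
      Q (fun2 (fun x y => x * sg y)) &
      Q (fun1 (fun x => x./2))].

Definition contains_pairing (Q : set mvfun) : Prop :=
  exists (c : nat -> nat -> nat) (c1 c2 : nat -> nat),
    [/\ bijective (fun p : nat * nat => c p.1 p.2),
        (forall x y : nat, c1 (c x y) = x /\ c2 (c x y) = y),
        Q (fun2 c), Q (fun1 c1) & Q (fun1 c2)].

Definition Gr (Q : set mvfun) : set (nat -> nat) :=
  [set f | exists g : nat -> nat,
     [/\ cancel f g, cancel g f, Q (fun1 f) & Q (fun1 g)]].

Definition char_fun (A : set nat) (x : nat) : nat := if x \in A then 1 else 0.

Definition regular (Q : set mvfun) (A : set nat) : Prop :=
  [/\ infinite_set A,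
      Q (fun1 (char_fun A)) &
      exists mu nu : nat -> nat,
        [/\ set_bij [set: nat] A nu,
            (forall n : nat, mu (nu n) = n),
            (forall x : nat, ~ A x -> mu x = 0),
            Q (fun1 mu) & Q (fun1 nu)]].

Definition has_regular_separation (Q : set mvfun) : Prop :=
  forall f : nat -> nat, Gr Q f ->
    exists A B : set nat,
      [/\ regular Q A /\ regular Q B,
          A `&` B = set0,
          (f @` A) `&` B = set0 &
          regular Q (~` A) /\ regular Q (~` B)].

(* The nonempty compositions of members of S; inverses are not adjoined. *)
Definition compositions (S : set (nat -> nat)) : set (nat -> nat) :=
  smallest (fun G : set (nat -> nat) =>
              forall f g : nat -> nat, G f -> G g -> G (f \o g)) S.

(* Main.v *)
Require Import Defs.
From mathcomp Require Import all_boot all_classical.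
From mathcomp Require Import zify.

(** The group G = Gr Q is first shown to be finitely generated.  By III every
    permutation of G is a product of two, each fixing pointwise a regular set
    with regular complement; such a permutation is conjugate to one moving only
    a single "level" of N = N x N x N, hence is a product of commutators of
    fixed involutions W1, W2 with other permutations.  A two-stack reversible
    machine, with one instruction per basis function, realises every f in G on
    the clean states emb x by Bennett's compute-use-uncompute trick, leaving
    its action elsewhere uncontrolled.  Conjugating the fixed permutations W1,
    W2 carried to the clean states then yields all permutations supported on
    clean states, as these two are trivial elsewhere.  Finally each involution
    is a product of three involutions, each avoiding one of three fixed
    disjoint sets, and can be moved into the clean states by three more
    generators.

    The same argument shows that G is generated by products p q of involutions
    with p q p = q p q; then p q = [q, p].  Split N into finitely many blocks,
    let a be their cyclic shift and b the involution acting on block 2^k as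
    the k-th of the finitely many involutions needed.  Differences of distinct
    powers of 2 being distinct, the commutator of b with a conjugate of b by a
    power of a is supported in one block, so a and b yield all permutations of
    a block.  A further component of b, exchanging one block with three
    others, spreads this to all of G.  As a and b have finite order, no
    inverses are needed. *)

Set Implicit Arguments.
Unset Strict Implicit.
Unset Printing Implicit Defensive.

Local Open Scope classical_set_scope.

(** * Closure properties of the class *)

Section FunctionClass.

Variable Q : set mvfun.
Hypothesis Qclosed : superposition_closed Q.
Hypothesis Qbasic : contains_basic_functions Q.

Definition q1 (f : nat -> nat) : Prop := Q (fun1 f).

Lemma q1_subst n (f : nfun n) (r : 'I_n -> nat -> nat) :
  Q (pack f) -> (forall i, q1 (r i) \/ r i = id) ->
  q1 (fun s => f [tuple r i s | i < n]).
Proof.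
move=> Qf Qr.
apply: (Qclosed (m := 1) (g := fun i x => r i (tnth x ord0)) Qf) => i.
by case: (Qr i) => [|->]; [left | right; exists ord0].
Qed.

Lemma q1_fun2_gen (op : nat -> nat -> nat) f g : Q (fun2 op) ->
  q1 f \/ f = id -> q1 g \/ g = id -> q1 (fun s => op (f s) (g s)).
Proof.
move=> Qop Qf Qg; pose r (i : 'I_2) := if i == ord0 then f else g.
have H i : q1 (r i) \/ r i = id by rewrite /r; case: ifP.
by have := q1_subst Qop H; congr q1; apply/funext => s /=; rewrite !tnth_mktuple.
Qed.

(** Projections need not belong to the class, but the identity is the term s + (s - s). *)
Lemma q1_id : q1 id.
Proof.
case: Qbasic => _ Qadd Qsub _ _.
have Q0 : q1 (fun s => s - s) by apply: (q1_fun2_gen Qsub); right.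
have -> : id = (fun s => s + (s - s)) by apply/funext => s; rewrite subnn addn0.
by apply: (q1_fun2_gen Qadd (f := id)); [right | left].
Qed.

Lemma q1_fun2 (op : nat -> nat -> nat) f g : Q (fun2 op) ->
  q1 f -> q1 g -> q1 (fun s => op (f s) (g s)).
Proof. by move=> Qop Qf Qg; apply: q1_fun2_gen => //; left. Qed.

Lemma q1_comp u f : q1 u -> q1 f -> q1 (fun s => u (f s)).
Proof.
move=> Qu Qf; have H (i : 'I_1) : q1 f \/ f = id by left.
by have := q1_subst Qu H; congr q1; apply/funext => s /=; rewrite tnth_mktuple.
Qed.

Lemma q1_add f g : q1 f -> q1 g -> q1 (fun s => f s + g s).
Proof. by apply: q1_fun2; case: Qbasic. Qed.

Lemma q1_sub f g : q1 f -> q1 g -> q1 (fun s => f s - g s).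
Proof. by apply: q1_fun2; case: Qbasic. Qed.

Lemma q1_mulsg f g : q1 f -> q1 g -> q1 (fun s => f s * sg (g s)).
Proof. by apply: (q1_fun2 (op := fun x y => x * sg y)); case: Qbasic. Qed.

Lemma q1_half f : q1 f -> q1 (fun s => (f s)./2).
Proof. by apply: (@q1_comp (fun x => x./2)); case: Qbasic. Qed.

Lemma q1_cst k : q1 (fun=> k).
Proof.
have Q1 : q1 (fun=> 1) by case: Qbasic.
elim: k => [|k IH]; first exact: (q1_sub Q1 Q1).
by have := q1_add IH Q1; congr q1; apply/funext => s; rewrite addn1.
Qed.

Lemma q1_succ f : q1 f -> q1 (fun s => (f s).+1).
Proof.
move=> Qf; under eq_fun do rewrite -addn1.
exact: q1_add Qf (q1_cst 1).
Qed.

Lemma q1_pred f : q1 f -> q1 (fun s => (f s).-1).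
Proof.
move=> Qf; under eq_fun do rewrite -subn1.
exact: q1_sub Qf (q1_cst 1).
Qed.

Definition dq (A : nat -> bool) : Prop := q1 (fun s => A s).

Lemma dq_leq f g : q1 f -> q1 g -> dq (fun s => f s <= g s).
Proof.
move=> Qf Qg; rewrite /dq; have := q1_sub (q1_cst 1) (q1_sub Qf Qg).
by congr q1; apply/funext => s; lia.
Qed.

Lemma dq_and A B : dq A -> dq B -> dq (fun s => A s && B s).
Proof.
move=> QA QB; have := q1_mulsg QA QB.
by congr q1; apply/funext => s; case: (A s); case: (B s).
Qed.

Lemma dq_not A : dq A -> dq (fun s => ~~ A s).
Proof.
move=> QA; have := q1_sub (q1_cst 1) QA.
by congr q1; apply/funext => s; case: (A s).
Qed.

Lemma dq_or A B : dq A -> dq B -> dq (fun s => A s || B s).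
Proof.
move=> /dq_not QA /dq_not QB; have := dq_not (dq_and QA QB).
by congr dq; apply/funext => s; case: (A s); case: (B s).
Qed.

Lemma dq_eq f g : q1 f -> q1 g -> dq (fun s => f s == g s).
Proof.
move=> Qf Qg; have := dq_and (dq_leq Qf Qg) (dq_leq Qg Qf).
by congr dq; apply/funext => s; rewrite -eqn_leq.
Qed.

Lemma dq_odd f : q1 f -> dq (fun s => odd (f s)).
Proof.
move=> Qf; have Qh := q1_half Qf; have := q1_sub Qf (q1_add Qh Qh).
congr q1; apply/funext => s /=; rewrite addnn -{1}(odd_double_half (f s)); lia.
Qed.

Lemma q1_if A f g : dq A -> q1 f -> q1 g ->
  q1 (fun s => if A s then f s else g s).
Proof.
move=> QA Qf Qg; have := q1_add (q1_mulsg Qf QA) (q1_mulsg Qg (dq_not QA)).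
congr q1; apply/funext => s; case: (A s); rewrite /sg /=; lia.
Qed.

(** As [r] takes fewer than [M + 1] values, nested case distinctions on it suffice, and the members
    [u k] may be unrelated to each other. *)
Lemma q1_family (M : nat) (u : nat -> nat -> nat) r f :
  (forall k, q1 (u k)) -> q1 r -> q1 f -> (forall s, r s < M) ->
  q1 (fun s => u (r s) (f s)).
Proof.
move=> Qu Qr Qf lt_rM.
have H k : q1 (fun s => if r s < k then u (r s) (f s) else 0).
  elim: k => [|k IH]; first exact: q1_cst.
  have := q1_if (dq_eq Qr (q1_cst k)) (q1_comp (Qu k) Qf) IH.
  congr q1; apply/funext => s; rewrite ltnS [in RHS]leq_eqVlt.
  by case: eqP => [->|].
by have := H M; under eq_fun do rewrite lt_rM.
Qed.

Variables (c : nat -> nat -> nat) (c1 c2 : nat -> nat).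
Hypothesis cK1 : forall x y, c1 (c x y) = x.
Hypothesis cK2 : forall x y, c2 (c x y) = y.
Hypothesis cK : forall v, c (c1 v) (c2 v) = v.
Hypothesis c00 : c 0 0 = 0.
Hypothesis Qc : Q (fun2 c).
Hypothesis Qc1 : q1 c1.
Hypothesis Qc2 : q1 c2.

Lemma q1_c f g : q1 f -> q1 g -> q1 (fun s => c (f s) (g s)).
Proof. exact: q1_fun2. Qed.

Lemma dq_comp A f : dq A -> q1 f -> dq (fun s => A (f s)).
Proof. exact: (@q1_comp (fun s => A s)). Qed.

(** Proves membership of a unary function by recursion on its syntax. *)
Ltac qc :=
  try rewrite /dq; cbv beta;
  lazymatch goal with
  | |- q1 (fun v => v) => exact: q1_id
  | |- q1 (fun _ => ?k) => exact (q1_cst k)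
  | |- q1 (fun v => nat_of_bool (negb (@?b v))) => apply: (@dq_not b); qc
  | |- q1 (fun v => nat_of_bool (andb (@?b v) (@?d v))) =>
      apply: (@dq_and b d); qc
  | |- q1 (fun v => nat_of_bool (orb (@?b v) (@?d v))) =>
      apply: (@dq_or b d); qc
  | |- q1 (fun v => nat_of_bool (odd (@?f v))) => apply: (@dq_odd f); qc
  | |- q1 (fun v => nat_of_bool (leq (@?f v) (@?g v))) =>
      apply: (@dq_leq f g); qc
  | |- q1 (fun v => nat_of_bool (eq_op (@?f v) (@?g v))) =>
      apply: (@dq_eq f g); qc
  | |- q1 (fun v => nat_of_bool (?A (@?f v))) =>
      apply: (@dq_comp A f); [assumption | qc]
  | |- q1 (fun v => addn (@?f v) (@?g v)) => apply: (@q1_add f g); qc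
  | |- q1 (fun v => subn (@?f v) (@?g v)) => apply: (@q1_sub f g); qc
  | |- q1 (fun v => half (@?f v)) => apply: (@q1_half f); qc
  | |- q1 (fun v => S (@?f v)) => apply: (@q1_succ f); qc
  | |- q1 (fun v => predn (@?f v)) => apply: (@q1_pred f); qc
  | |- q1 (fun v => c (@?f v) (@?g v)) => apply: (@q1_c f g); qc
  | |- q1 (fun v => ?u (@?f v)) =>
      apply: (@q1_comp u f); [assumption | qc]
  | |- q1 ?u => first [assumption | apply: q1_if; qc]
  end.

(** * Permutations in the class and regular sets *)

Definition inG (f g : nat -> nat) : Prop :=
  [/\ cancel f g, cancel g f, q1 f & q1 g].

Lemma inG_sym f g : inG f g -> inG g f.
Proof. by case. Qed.

Lemma inG_id : inG id id.
Proof. by split=> //; apply: q1_id. Qed.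

Lemma inG_comp f f' g g' : inG f f' -> inG g g' ->
  inG (f \o g) (g' \o f').
Proof.
move=> [fK f'K Qf Qf'] [gK g'K Qg Qg'].
by split; [exact: can_comp | exact: can_comp | exact: q1_comp | exact: q1_comp].
Qed.

Lemma inG_invol p : q1 p -> involutive p -> inG p p.
Proof. by []. Qed.

(** Regularity for boolean predicates. Injectivity of [nu] makes [A] infinite, and the
    characteristic function is recovered in [reg_dq]. *)
Definition reg (A : nat -> bool) : Prop :=
  exists mu nu, [/\ q1 mu, q1 nu, forall n, A (nu n), cancel nu mu &
                    forall x, A x -> nu (mu x) = x].

Lemma reg_ext A B : A =1 B -> reg A -> reg B.
Proof. by move=> /funext ->. Qed.

Lemma reg_dq A : reg A -> dq A.
Proof.
move=> [mu [nu [Qmu Qnu Anu _ Amu]]].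
have : dq (fun x => nu (mu x) == x) by qc.
by congr dq; apply/funext => x; apply/eqP/idP => [<-|/Amu].
Qed.

Lemma reg_range e e' : q1 e -> q1 e' -> cancel e e' ->
  reg (fun x => e (e' x) == x).
Proof. by move=> Qe Qe' eK; exists e', e; split=> // [n|x /eqP]; rewrite ?eK. Qed.

(* With T = S \ R and R identified with N x N, the bijection T + R -> R sends
   t to (t, 0) and (t, k) to (t, k + 1) for t in T, and fixes the rest of R. *)
Lemma reg_super R S : reg R -> dq S -> (forall x, R x -> S x) -> reg S.
Proof.
move=> regR dS RS; have dR := reg_dq regR.
case: regR => mu [nu [Qmu Qnu Rnu nuK muK]].
pose T x := S x && ~~ R x; have dT : dq T by rewrite /T; qc.
exists (fun v => if R v then
          (if T (c1 (mu v)) then c (c1 (mu v)) (c2 (mu v)).+1 else mu v)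
        else c v 0).
exists (fun n => if T (c1 n) then
          (if c2 n == 0 then c1 n else nu (c (c1 n) (c2 n).-1))
        else nu n).
split; [by qc | by qc | | |].
- move=> n; case: (boolP (T _)) => [/andP[Sn _]|_]; last exact: RS.
  by case: eqP => _ //; apply: RS.
- move=> n; case: (boolP (T _)) => [Tn|/negbTE nTn]; last by rewrite Rnu nuK nTn.
  case: eqP => [n0|/eqP n0].
    by move: Tn => /andP[_ /negbTE->]; rewrite -[in RHS](cK n) n0.
  by rewrite Rnu nuK cK1 cK2 Tn prednK ?lt0n // cK.
- move=> x Sx; case: (boolP (R x)) => [Rx|nRx]; last by rewrite cK1 cK2 /T Sx nRx.
  case: (boolP (T (c1 (mu x)))) => [Tx|/negbTE->]; last exact: muK.
  by rewrite cK1 cK2 Tx /= cK muK.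
Qed.

Lemma inG_glue A B u u' w w' : dq A -> dq B -> q1 u -> q1 u' -> q1 w -> q1 w' ->
  (forall x, A x -> B (u x) /\ u' (u x) = x) ->
  (forall y, B y -> A (u' y) /\ u (u' y) = y) ->
  (forall x, ~~ A x -> ~~ B (w x) /\ w' (w x) = x) ->
  (forall y, ~~ B y -> ~~ A (w' y) /\ w (w' y) = y) ->
  inG (fun x => if A x then u x else w x) (fun y => if B y then u' y else w' y).
Proof.
move=> dA dB Qu Qu' Qw Qw' HA HB HnA HnB; split; [| | by qc | by qc].
- by move=> x; case: (boolP (A x)) => [/HA[-> ->]|/HnA[/negbTE-> ->]].
- by move=> x; case: (boolP (B x)) => [/HB[-> ->]|/HnB[/negbTE-> ->]].
Qed.

Lemma reg_bij A B : reg A -> reg B -> exists u u', [/\ q1 u, q1 u',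
  forall x, A x -> B (u x) /\ u' (u x) = x &
  forall y, B y -> A (u' y) /\ u (u' y) = y].
Proof.
move=> [mA [nA [QmA QnA HA nAK mAK]]] [mB [nB [QmB QnB HB nBK mBK]]].
exists (fun x => nB (mA x)), (fun y => nA (mB y)).
split; [by qc | by qc | |].
- by move=> x Ax; rewrite HB nBK mAK.
- by move=> x Ax; rewrite HA nAK mBK.
Qed.

Lemma reg_perm A B : reg A -> reg (fun x => ~~ A x) ->
  reg B -> reg (fun x => ~~ B x) ->
  exists f g, inG f g /\ forall x, B (f x) = A x.
Proof.
move=> rA rnA rB rnB.
have [u [u' [Qu Qu' HA HB]]] := reg_bij rA rB.
have [w [w' [Qw Qw' HnA HnB]]] := reg_bij rnA rnB.
exists (fun x => if A x then u x else w x), (fun y => if B y then u' y else w' y).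
split; first by apply: inG_glue => //; exact: reg_dq.
by move=> x; case: (boolP (A x)) => [/HA[-> ]|/HnA[/negbTE->]].
Qed.

Lemma reg_halves A : reg A -> exists A0 A1 : nat -> bool, [/\ reg A0, reg A1,
  forall x, A0 x -> A x, forall x, A1 x -> A x & forall x, A0 x -> ~~ A1 x].
Proof.
move=> rA; have dA := reg_dq rA.
case: rA => mu [nu [Qmu Qnu Hnu nuK muK]].
exists (fun x => A x && ~~ odd (mu x)), (fun x => A x && odd (mu x)).
split; try by move=> x /andP[].
- exists (fun x => (mu x)./2), (fun n => nu (n + n)).
  split; [by qc | by qc | | |] => n.
  + by rewrite Hnu nuK addnn odd_double.
  + by rewrite nuK addnn doubleK.
  + by move=> /andP[An oddn]; rewrite addnn even_halfK ?muK.
- exists (fun x => (mu x)./2), (fun n => nu (n + n).+1).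
  split; [by qc | by qc | | |] => n.
  + by rewrite Hnu nuK addnn /= odd_double.
  + by rewrite nuK addnn /= uphalf_double.
  + move=> /andP[An oddn]; rewrite addnn -[RHS]muK //; congr nu.
    by rewrite -[RHS]odd_double_half oddn.
- by move=> x /andP[-> /negbTE->].
Qed.

Lemma regular_reg A : regular Q A -> reg (fun x => x \in A).
Proof.
move=> [_ _ [mu [nu [[nuA _ nuS] nuK _ Qmu Qnu]]]].
exists mu, nu; split=> // [n|x]; first by rewrite inE; apply: nuA.
by rewrite inE => /nuS[n _ <-]; rewrite nuK.
Qed.

(** * Factorization into permutations fixing regular sets *)

Definition fixes (B : nat -> bool) (f : nat -> nat) : Prop :=
  forall x, B x -> f x = x.

(** Split [A] into regular halves [A0] and [A1]. Let g be [f] on [A0] and the identity on [B]; this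
    is injective since f(A) misses [B]. The complements of the domain and of the image contain [A1]
    and f(A1), hence are regular, and any bijection between them completes g. Then g fixes [B], and
    the inverse of g followed after [f] fixes [A0]. *)
Lemma disjoint_image_factor f f' A B : inG f f' -> reg A -> reg B ->
    reg (fun x => ~~ B x) -> (forall x, A x -> B x -> False) ->
    (forall x, A x -> B (f x) -> False) ->
  exists g h g' h' B C, [/\ f = g \o h, inG g g' /\ inG h h',
    [/\ reg B, reg (fun x => ~~ B x) & fixes B g] &
    [/\ reg C, reg (fun x => ~~ C x) & fixes C h]].
Proof.
move=> Gf rA rB rnB AB fAB; have [fK f'K Qf Qf'] := Gf.
have [A0 [A1 [rA0 rA1 A0A A1A A01]]] := reg_halves rA.
have [dA0 dA1 dB] := And3 (reg_dq rA0) (reg_dq rA1) (reg_dq rB).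
have [u [u' [Qu Qu' H1 H2]]] : exists u u', [/\ q1 u, q1 u',
    forall x, ~~ (A0 x || B x) -> ~~ (A0 (f' (u x)) || B (u x)) /\ u' (u x) = x &
    forall y, ~~ (A0 (f' y) || B y) -> ~~ (A0 (u' y) || B (u' y)) /\ u (u' y) = y].
  apply: (@reg_bij (fun x => ~~ (A0 x || B x)) (fun y => ~~ (A0 (f' y) || B y))).
    apply: (reg_super rA1); first by qc.
    move=> x A1x; apply/norP; split; last by apply/negP => /(AB x (A1A x A1x)).
    by apply/negP => /A01; rewrite A1x.
  have rfA1 : reg (fun y => A1 (f' y)).
    case: (rA1) => mu [nu [Qmu Qnu Anu nuK muK]].
    exists (fun y => mu (f' y)), (fun n => f (nu n)).
    by split=> [||n|n|x A1x]; rewrite ?fK ?muK ?f'K //; qc.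
  apply: (reg_super rfA1); first by qc.
  move=> y A1y; apply/norP; split; last first.
    by apply/negP; rewrite -{1}(f'K y) => /(fAB _ (A1A _ A1y)).
  by apply/negP => /A01; rewrite A1y.
have fixB y : B y -> A0 (f' y) = false.
  by move=> By; apply/negP => /A0A /fAB; rewrite f'K; apply.
have fixB' y : B y -> A0 y = false.
  by move=> By; apply/negP => /A0A /AB; apply.
have dA0' : dq (fun y => A0 (f' y)) by qc.
(* Here [w] is the factor g, and [w'] is the equation describing it on the union of [A0] and [B]. *)
have [w w' HG] : exists2 g, forall x, A0 x || B x ->
    g x = (if A0 x then f x else x) & exists g', inG g g'.
  exists (fun x => if A0 x || B x then (if A0 x then f x else x) else u x).
    by move=> x ->.
  exists (fun y => if A0 (f' y) || B y then (if A0 (f' y) then f' y else y) else u' y).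
  apply: inG_glue => //; [by qc | by qc | by qc | by qc | |].
  - move=> x; case: ifP => [A0x _|_ /= Bx]; first by rewrite fK A0x.
    by rewrite fixB // Bx.
  - move=> x; case: ifP => [A0x _|_ /= Bx]; first by rewrite A0x f'K.
    by rewrite fixB' // Bx.
case: HG => g' Gg; have [gK g'K Qg Qg'] := Gg.
exists w, (g' \o f), g', (f' \o w), B, A0; split.
- by apply/funext => x /=; rewrite g'K.
- by split=> //; apply: inG_comp; first exact: inG_sym.
- by split=> // x Bx; rewrite w' ?Bx ?orbT // fixB'.
- split=> // [|x A0x /=].
    by apply: (reg_super rA1) => [|x]; [qc | apply: contraL => /A01].
  have <- : w x = f x by rewrite w' A0x.
  by rewrite gK.
Qed.

Lemma separation_factor f : has_regular_separation Q -> Gr Q f ->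
  exists g h g' h' B C, [/\ f = g \o h, inG g g' /\ inG h h',
    [/\ reg B, reg (fun x => ~~ B x) & fixes B g] &
    [/\ reg C, reg (fun x => ~~ C x) & fixes C h]].
Proof.
move=> sep Gf; have [A [B [[/regular_reg rA /regular_reg rB] AB0 fAB0]]] := sep _ Gf.
move=> [_ /regular_reg rnB]; case: Gf => f' Gf.
apply: (disjoint_image_factor Gf rA rB).
- by apply: reg_ext rnB => x; rewrite in_setC.
- by move=> x; rewrite !inE => Ax Bx; suff : set0 x by []; rewrite -AB0.
- move=> x; rewrite !inE => Ax Bx; suff : set0 (f x) by [].
  by rewrite -fAB0; split=> //; exists x.
Qed.

(** * Generation by commutators and involutions *)

Lemma inG_conj p p' f f' : inG p p' -> inG f f' -> inG (p \o f \o p') (p \o f' \o p').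
Proof.
move=> Gp Gf; have Gp' := inG_sym Gp.
exact: inG_comp (inG_comp Gp Gf) Gp'.
Qed.

Definition trip (F : nat -> nat -> nat -> nat) v :=
  F (c1 v) (c1 (c2 v)) (c2 (c2 v)).

Definition mkt x m r := c x (c m r).

Lemma trip_mkt F x m r : trip F (mkt x m r) = F x m r.
Proof. by rewrite /trip /mkt !(cK1, cK2). Qed.

Lemma mkt_ind (P : nat -> Prop) : (forall x m r, P (mkt x m r)) -> forall v, P v.
Proof. by move=> H v; have := H (c1 v) (c1 (c2 v)) (c2 (c2 v)); rewrite /mkt !cK. Qed.

(** On the pairs (m, r), [W1] exchanges (m, 0) with (m, 1), while [W2] exchanges (m, 1) with (m + 1,
    0) and so leaves (0, 0) alone. [V] exchanges (m, 1) with (m, 2): it shares one point with each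
    exchange in r = 1, which gives the braid relations, and it avoids r = 0, where [slot0] acts. *)
Definition W1 := trip (fun x m r =>
  if r == 0 then mkt x m 1 else if r == 1 then mkt x m 0 else mkt x m r).

Definition W2 := trip (fun x m r =>
  if r == 1 then mkt x m.+1 0
  else if (r == 0) && (0 < m) then mkt x m.-1 1 else mkt x m r).

Definition V := trip (fun x m r =>
  if r == 1 then mkt x m 2 else if r == 2 then mkt x m 1 else mkt x m r).

Definition slot0 f := trip (fun x m r =>
  if r == 0 then mkt (f x) m r else mkt x m r).

Lemma q1_W1 : q1 W1. Proof. rewrite /W1 /trip /mkt; qc. Qed.
Lemma q1_W2 : q1 W2. Proof. rewrite /W2 /trip /mkt; qc. Qed.
Lemma q1_V : q1 V. Proof. rewrite /V /trip /mkt; qc. Qed.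
Lemma q1_slot0 f : q1 f -> q1 (slot0 f).
Proof. by move=> Qf; rewrite /slot0 /trip /mkt; qc. Qed.

Ltac slots := elim/mkt_ind=> x [|m] [|[|[|r]]];
  rewrite /W1 /W2 /V /slot0 /=; do 9?[rewrite trip_mkt /=].

Lemma W1K : involutive W1. Proof. by slots. Qed.
Lemma W2K : involutive W2. Proof. by slots. Qed.
Lemma VK : involutive V. Proof. by slots. Qed.

Lemma inG_slot0 f g : inG f g -> inG (slot0 f) (slot0 g).
Proof.
move=> [fK gK Qf Qg]; split; [| | exact: q1_slot0 | exact: q1_slot0].
- by slots; rewrite ?fK.
- by slots; rewrite ?gK.
Qed.

Lemma slot0V f v : slot0 f (V v) = V (slot0 f v).
Proof. by move: v; slots. Qed.

Definition braid p q :=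
  [/\ inG p p, inG q q & forall x, p (q (p x)) = q (p (q x))].

Lemma braidW1V : braid W1 V.
Proof.
split; [exact: inG_invol q1_W1 W1K | exact: inG_invol q1_V VK |].
by slots.
Qed.

Lemma braidW2V : braid W2 V.
Proof.
split; [exact: inG_invol q1_W2 W2K | exact: inG_invol q1_V VK |].
by slots.
Qed.

Lemma c1_0 : c1 0 = 0. Proof. by rewrite -[in c1 _]c00 cK1. Qed.
Lemma c2_0 : c2 0 = 0. Proof. by rewrite -[in c2 _]c00 cK2. Qed.

Lemma reg_column k : reg (fun v => c2 v == k).
Proof.
have Qe : q1 (fun x => c x k) by qc.
have eK : cancel (fun x => c x k) c1 by move=> x; rewrite cK1.
apply: reg_ext (reg_range Qe Qc1 eK) => v.
by rewrite -{2}(cK v); apply/eqP/eqP => [/(congr1 c2)|->//]; rewrite !cK2.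
Qed.

Lemma reg_cocolumn k : reg (fun v => c2 v != k).
Proof.
apply: (reg_super (reg_column k.+1)); first by qc.
by move=> v /eqP->; rewrite neq_ltn ltnSn orbT.
Qed.

Definition level0 v := c2 v == 0.

(** A telescoping product. Let g be the action of [f] on (0, 0). The first commutator acts as g on
    every (m, 0) and as its inverse on every (m, 1). The second acts as g on every (m, 1) and as its
    inverse on every (m + 1, 0), but trivially on (0, 0), which [W2] fixes. Only g on (0, 0)
    survives. *)
Lemma level0_split f f' : inG f f' -> fixes (fun v => ~~ level0 v) f ->
  exists g g', inG g g' /\
    f =1 slot0 g \o W1 \o slot0 g' \o W1 \o (slot0 g' \o W2 \o slot0 g \o W2).
Proof.
move=> Gf fixf; have [fK f'K Qf Qf'] := Gf.
have fixf' : fixes (fun v => ~~ level0 v) f'.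
  by move=> v nv; rewrite -{1}(fixf v nv) fK.
have stab h h' : inG h h' -> fixes (fun v => ~~ level0 v) h -> forall x,
    h (c x 0) = c (c1 (h (c x 0))) 0.
  move=> [hK _ _ _] fixh x; rewrite -[LHS]cK; congr c; apply/eqP/negPn/negP => nv.
  have := fixh _ nv => /(can_inj hK) E; move: nv.
  by rewrite /level0 E cK2.
have stabf := stab _ _ Gf fixf.
have stabf' := stab _ _ (inG_sym Gf) fixf'.
pose g x := c1 (f (c x 0)); pose g' x := c1 (f' (c x 0)).
have gK : cancel g g' by move=> x; rewrite /g' /g -stabf fK cK1.
have g'K : cancel g' g by move=> x; rewrite /g' /g -stabf' f'K cK1.
exists g, g'; split; first by split=> //; rewrite /g /g'; qc.
have f0 x : f (mkt x 0 0) = mkt (g x) 0 0 by rewrite /mkt c00 stabf.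
have fpos x m r : 0 < m + r -> f (mkt x m r) = mkt x m r.
  move=> mr; apply: fixf; rewrite /level0 cK2; apply/eqP => mr0.
  by have := congr1 c1 mr0; have := congr1 c2 mr0; rewrite cK1 cK2 c1_0 c2_0; lia.
by slots; rewrite ?f0 ?fpos ?gK ?g'K.
Qed.

(* A permutation fixing a regular coregular set is conjugate to one acting on
   level (0, 0) only, which is a product of two commutators. *)
Lemma commutator_generation (K : set (nat -> nat)) :
  has_regular_separation Q ->
  (forall f g, K f -> K g -> K (f \o g)) ->
  (forall p p' g g' W, inG p p' -> inG g g' -> W = W1 \/ W = W2 ->
     K (p \o (slot0 g \o W \o slot0 g' \o W) \o p')) ->
  Gr Q `<=` K.
Proof.
move=> sep Kc Kw f Gf.
suff Kfix g g' B : inG g g' -> reg B -> reg (fun x => ~~ B x) -> fixes B g -> K g.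
  have [g [h [g' [h' [B [C [-> [Gg Gh] [rB rnB fB] [rC rnC fC]]]]]]]] :=
    separation_factor sep Gf.
  by apply: Kc; [exact: Kfix Gg rB rnB fB | exact: Kfix Gh rC rnC fC].
move=> Gg rB rnB fB.
have r0 : reg level0 := reg_column 0.
have rn0 : reg (fun v => ~~ level0 v) := reg_cocolumn 0.
have rnnB : reg (fun x => ~~ ~~ B x) by apply: reg_ext rB => x; rewrite negbK.
have [p [p' [Gp Ep]]] := reg_perm rnB rnnB r0 rn0.
have Gpg := inG_conj Gp Gg; have [pK p'K _ _] := Gp.
have fpg : fixes (fun v => ~~ level0 v) (p \o g \o p').
  by move=> v; rewrite -{1}(p'K v) Ep negbK /= => /fB ->.
have [k [k' [Gk Ek]]] := level0_split Gpg fpg.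
have -> : g = (p' \o (slot0 k \o W1 \o slot0 k' \o W1) \o p) \o
              (p' \o (slot0 k' \o W2 \o slot0 k \o W2) \o p).
  apply/funext => x /=; rewrite p'K; have /= := Ek (p x).
  by rewrite pK => <-; rewrite pK.
have Gk' := inG_sym Gk; have Gp' := inG_sym Gp.
by apply: Kc; apply: Kw => //; [left | right].
Qed.

(** Inserting [V \o V] splits the commutator of [slot0 g] and [W] into a conjugate of [W] times [V],
    and [V] times [W]. Since [V] commutes with [slot0 g], that conjugate also satisfies the braid
    relation with [V]. *)
Lemma braid_generation (K : set (nat -> nat)) :
  has_regular_separation Q ->
  (forall f g, K f -> K g -> K (f \o g)) ->
  (forall p q, braid p q -> K (p \o q)) ->
  Gr Q `<=` K.
Proof.
move=> sep Kc Kb; apply: commutator_generation => // p p' g g' W Gp Gg HW.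
have [pK p'K _ _] := Gp; have [gK g'K _ _] := Gg.
have {HW} [GW GV WV] : braid W V by case: HW => ->; [exact: braidW1V | exact: braidW2V].
have [WK _ _ _] := GW.
have Gs := inG_slot0 Gg; have [sK s'K _ _] := Gs.
have -> : p \o (slot0 g \o W \o slot0 g' \o W) \o p' =
    ((p \o (slot0 g \o W \o slot0 g') \o p') \o (p \o V \o p')) \o
    ((p \o V \o p') \o (p \o W \o p')).
  by apply/funext => x /=; rewrite !pK VK.
apply: Kc; apply: Kb; split; try exact: inG_conj; try exact: inG_conj (inG_conj _ _).
- move=> x /=; rewrite !pK; congr p; by rewrite !slot0V sK WV slot0V.
- by move=> x /=; rewrite !pK WV.
Qed.

(** * Subgroups containing all permutations supported in a set *)

Lemma compositions_comp S f g :
  compositions S f -> compositions S g -> compositions S (f \o g).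
Proof. by move=> Sf Sg K HK; have [Kc _] := HK; apply: Kc; [exact: Sf | exact: Sg]. Qed.

Definition fgroup (H : set (nat -> nat)) : Prop :=
  (forall f g, H f -> H g -> H (f \o g)) /\
  (forall h, H h -> exists2 h', H h' & inG h h').

Lemma fgroup_compositions S :
  (forall s, S s -> exists2 s', compositions S s' & inG s s') ->
  fgroup (compositions S).
Proof.
move=> Sinv; split=> [f g|h Hh]; first exact: compositions_comp.
pose K := [set h | compositions S h /\ exists2 h', compositions S h' & inG h h'].
have subK : compositions S `<=` K.
  apply: smallest_sub => [f g [Sf [f' Sf' Gf]] [Sg [g' Sg' Gg]]|s Ss].
    split; first exact: compositions_comp.
    by exists (g' \o f'); [exact: compositions_comp | exact: inG_comp].
  by split; [exact: sub_gen_smallest | exact: Sinv].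
by have [] := subK h Hh.
Qed.

Lemma fgroup_id (H : set (nat -> nat)) h : fgroup H -> H h -> H id.
Proof.
move=> [Hc Hi] Hh; have [h' Hh' [hK _ _ _]] := Hi _ Hh.
by rewrite (_ : id = h' \o h); [exact: Hc | apply/funext => x /=; rewrite hK].
Qed.

Definition symin (X : nat -> bool) (H : set (nat -> nat)) : Prop :=
  forall f f', inG f f' -> fixes (fun v => ~~ X v) f -> H f.

Lemma fixes_stable X f f' : inG f f' -> fixes (fun v => ~~ X v) f ->
  forall v, X v -> X (f v).
Proof.
move=> [fK _ _ _] fixf v Xv; apply/negPn/negP => nX.
have /(can_inj fK) E := fixf _ nX.
by rewrite E Xv in nX.
Qed.

Lemma fixes_inv X f f' : inG f f' -> fixes X f -> fixes X f'.
Proof. by move=> [fK _ _ _] fixf x /fixf {1}<-. Qed.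

Lemma symin_sub (X Y : nat -> bool) H : (forall v, Y v -> X v) -> symin X H -> symin Y H.
Proof.
move=> YX sX f f' Gf fixf; apply: sX Gf _ => v nX.
by apply: fixf; apply: contra nX; apply: YX.
Qed.

(** Conjugation by [h] turns support in [Y] into support in [X]. *)
Lemma symin_transport (X Y : nat -> bool) H h : fgroup H -> H h ->
  (forall v, Y v -> X (h v)) -> symin X H -> symin Y H.
Proof.
move=> [Hc Hinv] Hh YX sX f f' Gf fixf.
have [h' Hh' Gh] := Hinv _ Hh; have [hK h'K _ _] := Gh.
have -> : f = h' \o (h \o f \o h') \o h by apply/funext => x /=; rewrite !hK.
apply: (Hc _ _ _ Hh); apply: (Hc _ _ Hh'); apply: (sX _ _ (inG_conj Gh Gf)).
by move=> v nX /=; rewrite fixf ?h'K //; apply: contra nX => /YX; rewrite h'K.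
Qed.

(** The action of [f] carried along an injection [e] with left inverse [e']; the test recognises the
    range of [e]. *)
Definition hat (e e' f : nat -> nat) v := if e (e' v) == v then e (f (e' v)) else v.

Lemma hat_comp e e' f g : cancel e e' -> hat e e' (f \o g) = hat e e' f \o hat e e' g.
Proof.
move=> eK; apply/funext => v; rewrite /hat /=.
by case: (boolP (e (e' v) == v)) => [_|/negbTE nv]; rewrite ?eK ?eqxx ?nv.
Qed.

Lemma hat_id e e' : hat e e' id = id.
Proof. by apply/funext => v; rewrite /hat; case: eqP. Qed.

Lemma inG_hat e e' f f' : q1 e -> q1 e' -> cancel e e' -> inG f f' ->
  inG (hat e e' f) (hat e e' f').
Proof.
move=> Qe Qe' eK [fK f'K Qf Qf']; split; [| | by rewrite /hat; qc | by rewrite /hat; qc].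
- move=> v; rewrite -[LHS]/((hat e e' f' \o hat e e' f) v) -hat_comp //.
  by rewrite (_ : f' \o f = id) ?hat_id //; apply/funext.
- move=> v; rewrite -[LHS]/((hat e e' f \o hat e e' f') v) -hat_comp //.
  by rewrite (_ : f \o f' = id) ?hat_id //; apply/funext.
Qed.

Lemma symin_range e e' H : q1 e -> q1 e' -> cancel e e' ->
  (forall f, Gr Q f -> H (hat e e' f)) -> symin (fun v => e (e' v) == v) H.
Proof.
move=> Qe Qe' eK Hhat f f' Gf fixf; have [fK f'K Qf Qf'] := Gf.
have st x : e (e' (f (e x))) = f (e x).
  by apply/eqP; apply: (fixes_stable Gf fixf); rewrite eK.
have st' x : e (e' (f' (e x))) = f' (e x).
  apply/eqP; apply: (fixes_stable (inG_sym Gf) (fixes_inv Gf fixf)).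
  by rewrite eK.
have -> : f = hat e e' (e' \o f \o e).
  apply/funext => v; rewrite /hat /=; case: (boolP (_ == v)) => [/eqP|/fixf->//].
  by rewrite st => ->.
apply: Hhat; exists (e' \o f' \o e).
rewrite -/(inG _ _); split; [| | by rewrite /comp; qc | by rewrite /comp; qc].
- by move=> x /=; rewrite st fK eK.
- by move=> x /=; rewrite st' f'K eK.
Qed.

(* An involution is cut into involutions, each moving only points outside one
   of three disjoint sets: a pair {v, s v} meets at most two of them. *)
Lemma involution_in_classes (X : nat -> nat -> bool) H s :
  (forall f g, H f -> H g -> H (f \o g)) ->
  (forall j, j < 3 -> dq (X j) /\ symin (fun v => ~~ X j v) H) ->
  (forall i j v, i < 3 -> j < 3 -> X i v -> X j v -> i = j) ->
  q1 s -> involutive s -> H s.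
Proof.
move=> Hc HX disj Qs sK.
have [[d0 s0] [d1 s1] [d2 s2]] := And3 (HX 0 isT) (HX 1 isT) (HX 2 isT).
(* [J v] names a set missed by both [v] and [s v]. The value 2 arises only when the pair meets the
   sets 0 and 1, and then disjointness keeps it off the set 2. *)
pose J v := if ~~ X 0 v && ~~ X 0 (s v) then 0
            else if ~~ X 1 v && ~~ X 1 (s v) then 1 else 2.
have Js v : J (s v) = J v by rewrite /J sK ![_ && ~~ X _ v]andbC.
pose piece j v := if J v == j then s v else v.
have Gp j : inG (piece j) (piece j).
  apply: inG_invol; first by rewrite /piece /J; qc.
  move=> v; rewrite /piece; case: (boolP (J v == j)) => [E|/negbTE -> //].
  by rewrite Js E sK.
have Jn v j : J v = j -> ~~ X j v.
  move=> <-; rewrite /J; case: ifP => [/andP[]//|/nandP]; rewrite !negbK => X0.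
  case: ifP => [/andP[]//|/nandP]; rewrite !negbK => X1; apply/negP => X2.
  have n0 : X 0 v = false by apply/negP => /(disj 0 2) E; have := E isT isT X2.
  have n1 : X 1 v = false by apply/negP => /(disj 1 2) E; have := E isT isT X2.
  case: X0 X1; rewrite ?n0 // => X0; case; rewrite ?n1 // => X1.
  by have := disj 0 1 _ isT isT X0 X1.
have Hp j : j < 3 -> H (piece j).
  move=> j3; have [_ sj] := HX j j3; apply: sj (Gp j) _ => v; rewrite negbK => Xj.
  by rewrite /piece; case: eqP => // /Jn; rewrite Xj.
have -> : s = piece 0 \o piece 1 \o piece 2.
  apply/funext => v; rewrite /piece /=.
  have := Js v; case E: (J v) => [|[|[|k]]] Es; rewrite /= ?E ?Es //= ?E ?Es //.
  by move: E; rewrite /J; do 2 case: ifP => //.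
exact: (Hc _ _ (Hc _ _ (Hp 0 isT) (Hp 1 isT)) (Hp 2 isT)).
Qed.

Lemma generation_by_classes (X : nat -> nat -> bool) H : has_regular_separation Q ->
  (forall f g, H f -> H g -> H (f \o g)) ->
  (forall j, j < 3 -> dq (X j) /\ symin (fun v => ~~ X j v) H) ->
  (forall i j v, i < 3 -> j < 3 -> X i v -> X j v -> i = j) ->
  Gr Q `<=` H.
Proof.
move=> sep Hc HX disj; apply: braid_generation => // p q [[pK _ Qp _] [qK _ Qq _] _].
by apply: (Hc); apply: (involution_in_classes Hc HX disj).
Qed.

(** * Reversible two-stack computation *)

(** A state pairs a left stack [c1 v] with a right stack [c2 v]. [rot] moves the top of the right
    stack onto the left one, and [swp] exchanges the top two letters of the right stack. *)
Definition rot v := c (c (c1 (c2 v)) (c1 v)) (c2 (c2 v)).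
Definition unrot v := c (c2 (c1 v)) (c (c1 (c1 v)) (c2 v)).
Definition swp v :=
  c (c1 v) (c (c1 (c2 (c2 v))) (c (c1 (c2 v)) (c2 (c2 (c2 v))))).

(* The transposition of 0 and a, applied to y: a reversible assignment which
   turns 0 into a and a into 0. *)
Definition tr a y := if y == 0 then a else if y == a then 0 else y.

Definition load n (f : nfun n) v :=
  c (c1 v) (c (tr (f [tuple c1 (iter i c2 (c2 (c2 v))) | i < n]) (c1 (c2 v)))
              (c2 (c2 v))).

Lemma trK a : involutive (tr a).
Proof.
move=> y; rewrite /tr; case: (boolP (y == 0)) => [/eqP->|y0].
  by rewrite eqxx; case: eqP.
by case: (boolP (y == a)) => [/eqP<-|/negbTE ya] /=; rewrite ?(negbTE y0) ?ya.
Qed.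

Lemma inG_rot : inG rot unrot.
Proof.
split; [| | by rewrite /rot; qc | by rewrite /unrot; qc] => v.
  by rewrite /rot /unrot !(cK1, cK2) !cK.
by rewrite /rot /unrot !(cK1, cK2) !cK.
Qed.

Lemma inG_swp : inG swp swp.
Proof.
apply: inG_invol => [|v]; first by rewrite /swp; qc.
by rewrite /swp !(cK1, cK2) !cK.
Qed.

Lemma inG_load n (f : nfun n) : Q (pack f) -> inG (load f) (load f).
Proof.
move=> Qf; apply: inG_invol => [|v]; last first.
  by rewrite /load !(cK1, cK2) trK !cK.
have Qi i : q1 (iter i c2).
  by elim: i => [|i IH]; [exact: q1_id | apply: (q1_comp Qc2 IH)].
pose r (i : 'I_n) v := c1 (iter i c2 (c2 (c2 v))).
have Qr (i : 'I_n) : q1 (r i) \/ r i = id by left; rewrite /r; have := Qi i => ?; qc.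
suff Qload g : q1 g ->
    q1 (fun v => c (c1 v) (c (tr (g v) (c1 (c2 v))) (c2 (c2 v)))).
  exact: Qload (q1_subst Qf Qr).
by move=> Qg; rewrite /tr; qc.
Qed.

(** The letters [l] lie above an infinite supply of blanks, because [c 0 0 = 0]. *)
Definition st d (l : seq nat) := c d (foldr c 0 l).

Lemma rot_st d a l : rot (st d (a :: l)) = st (c a d) l.
Proof. by rewrite /rot /st /= !(cK1, cK2). Qed.

Lemma swp_st d a b l : swp (st d [:: a, b & l]) = st d [:: b, a & l].
Proof. by rewrite /swp /st /= !(cK1, cK2). Qed.

Lemma st_blank d l : st d (l ++ [:: 0]) = st d l.
Proof. by rewrite /st foldr_cat /= c00. Qed.

Lemma load_st n (f : nfun n) d y (x : n.-tuple nat) r :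
  load f (st d (y :: x ++ r)) = st d (tr (f x) y :: x ++ r).
Proof.
have H i l : c1 (iter i c2 (foldr c 0 l)) = nth 0 l i.
  elim: i l => [|i IH] [|a l]; rewrite ?iterSr /= ?cK1 ?cK2 ?c1_0 ?c2_0 //.
  by have := IH [::]; rewrite nth_nil.
rewrite /load /st /= !(cK1, cK2); congr (c d (c (tr (f _) y) _)).
apply: eq_from_tnth => i; rewrite tnth_mktuple H nth_cat size_tuple ltn_ord.
by rewrite (tnth_nth 0).
Qed.

Section Machine.

Variable H : set (nat -> nat).
Hypothesis groupH : fgroup H.
Hypothesis Hrot : H rot.
Hypothesis Hswp : H swp.
Hypothesis Hcopy : H (load (fun x : 1.-tuple nat => tnth x ord0)).

Let Hid : H id := fgroup_id groupH Hrot.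

Lemma rot_many n : exists2 h, H h & forall l, size l = n ->
  exists k : nat -> nat, forall d r, h (st d (l ++ r)) = st (k d) r.
Proof.
elim: n => [|n [h Hh hE]].
  by exists id; [exact: Hid | case=> // _; exists id].
exists (h \o rot); first exact: groupH.1.
case=> // a l [/hE[k kE]]; exists (fun d => k (c a d)) => d r /=.
by rewrite rot_st kE.
Qed.

(** Conjugating [h] by [n] rotations lets it act beneath the top [n] letters. The rotations change
    the left stack, hence the hypothesis for every [d]. *)
Lemma run_under n h : H h -> exists2 h', H h' & forall l r r', size l = n ->
  (forall d, h (st d r) = st d r') -> forall d, h' (st d (l ++ r)) = st d (l ++ r').
Proof.
move=> Hh; have [Hc Hi] := groupH; have [k Hk kE] := rot_many n.
have [k' Hk' [kK _ _ _]] := Hi _ Hk.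
exists (k' \o h \o k) => [|l r r' ln hE d /=]; first exact: (Hc _ _ (Hc _ _ _ _)).
by have [u uE] := kE l ln; rewrite uE hE -uE kK.
Qed.

Lemma move_top n : exists2 h, H h & forall d y l r, size l = n ->
  h (st d (y :: l ++ r)) = st d (l ++ y :: r).
Proof.
elim: n => [|n [h Hh hE]].
  by exists id; [exact: Hid | move=> d y [|]].
have [k Hk kE] := run_under 1 Hh.
exists (k \o swp); first exact: groupH.1.
move=> d y [|a l] r //= [ln]; rewrite swp_st.
by apply: (kE [:: a] _ (l ++ y :: r)) => // d'; apply: hE.
Qed.

Lemma swap_blocks m n : exists2 h, H h & forall d l1 l2 r,
  size l1 = m -> size l2 = n -> h (st d (l1 ++ l2 ++ r)) = st d (l2 ++ l1 ++ r).
Proof.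
elim: n => [|n [h Hh hE]].
  by exists id; [exact: Hid | move=> d l1 [|]].
have [Hc Hi] := groupH; have [k Hk kE] := run_under 1 Hh.
have [t /Hi[t' Ht' [tK _ _ _]] tE] := move_top m.
exists (k \o t'); first exact: Hc.
move=> d l1 [|a l2] r // l1m [l2n] /=; rewrite -tE // tK.
by apply: (kE [:: a] _ (l2 ++ l1 ++ r)) => // d'; apply: hE.
Qed.

(** Only stacks with blanks beneath the arguments are controlled, but the left stack and the target
    letter [y] are arbitrary. *)
Definition computable n (f : nfun n) : Prop := exists2 h, H h &
  forall d y (x : n.-tuple nat), h (st d (y :: x)) = st d (tr (f x) y :: x).

Lemma computable_load n (f : nfun n) : H (load f) -> computable f.
Proof.
by move=> Hf; exists (load f) => // d y x; have := load_st f d y x [::]; rewrite !cats0.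
Qed.

(** The target is moved next to argument [j], that argument is copied into it, and the move is
    undone. *)
Lemma computable_proj n (j : 'I_n) : computable (Defs.proj j).
Proof.
have [Hc Hi] := groupH; have [t Ht tE] := move_top j.
have [t' Ht' [tK _ _ _]] := Hi _ Ht; have [k Hk kE] := run_under j Hcopy.
exists (t' \o k \o t); first exact: (Hc _ _ (Hc _ _ _ _)).
move=> d y x /=; rewrite /Defs.proj (tnth_nth 0).
have szj : size (take j x) = j by rewrite size_takel // size_tuple ltnW.
have Ex : tval x = take j x ++ nth 0 x j :: drop j.+1 x.
  by rewrite -drop_nth ?size_tuple // cat_take_drop.
rewrite [in LHS]Ex tE // (kE _ _ (tr (nth 0 x j) y :: nth 0 x j :: drop j.+1 x)) //.
  by rewrite -tE // tK -Ex.
by move=> d'; apply: (load_st _ _ _ [tuple nth 0 x j]).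
Qed.

Lemma computable_many n (gs : seq (nfun n)) : (forall g, List.In g gs -> computable g) ->
  exists2 h, H h & forall d (x : n.-tuple nat),
    h (st d x) = st d ([seq g x | g <- gs] ++ x).
Proof.
have [Hc Hi] := groupH; elim/last_ind: gs => [|gs g IH] Hgs.
  by exists id; first exact: Hid.
have [|h Hh hE] := IH; first by move=> g' Hg';
  apply: Hgs; rewrite -cats1; apply/List.in_or_app; left.
have [|k Hk kE] := Hgs g; first by rewrite -cats1; apply/List.in_or_app; right; left.
have [t /Hi[t' Ht' [tK _ _ _]] tE] := move_top n.
have [u Hu uE] := run_under (size gs) (Hc _ _ Hk Ht').
exists (u \o h); first exact: Hc.
move=> d x /=; rewrite hE map_rcons cat_rcons.
apply: uE => [|d' /=]; first by rewrite size_map.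
(* [t'] fetches a blank from beneath the arguments to the top, and [tr (g x) 0] is [g x]. *)
by rewrite -st_blank -tE ?size_tuple // tK cats0 kE.
Qed.

(* Bennett's compute-use-uncompute scheme. *)
Lemma computable_substitute n m (f : nfun n) (g : 'I_n -> nfun m) :
  computable f -> (forall i, computable (g i)) -> computable (substitute f g).
Proof.
move=> [kf Hkf kfE] Cg; have [Hc Hi] := groupH.
have [|h Hh hE] := @computable_many m [seq g i | i <- enum 'I_n].
  by move=> g' /List.in_map_iff[i [<- _]]; apply: Cg.
have [a Ha aE] := run_under 1 Hh; have [a' Ha' [aK _ _ _]] := Hi _ Ha.
(* The program for [f] expects blanks beneath its arguments, so the target and the computed values
   are moved below [x] before it runs. *)
have [b Hb bE] := swap_blocks n.+1 m; have [b' Hb' [bK _ _ _]] := Hi _ Hb.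
have [k Hk kE] := run_under m Hkf.
exists (a' \o (b' \o (k \o (b \o a)))); first by do 4 (apply: (Hc) => //).
move=> d y x; pose z := [tuple g i x | i < n].
have {}aE d' y' : a (st d' (y' :: x)) = st d' ((y' :: z) ++ x ++ [::]).
  rewrite cats0; apply: (aE [:: y'] x (z ++ x)) => // d''.
  by rewrite hE -map_comp.
have {}bE d' y' : b (st d' ((y' :: z) ++ x ++ [::])) = st d' (x ++ y' :: z).
  by rewrite bE ?cats0 ?size_tuple //; congr _.+1; apply: size_tuple.
rewrite /= aE bE (kE _ _ (tr (f z) y :: z)) ?size_tuple // -bE bK -aE aK.
by [].
Qed.

Lemma computable_closure Phi : (forall F, Phi F -> H (load (tagged F))) ->
  forall F, superposition_closure Phi F -> computable (tagged F).
Proof.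
move=> HPhi; apply: (@smallest_sub _ superposition_closed Phi [set F | computable (tagged F)]).
  move=> n m f g /= Cf Cg; apply: computable_substitute => // i.
  by case: (Cg i) => [//|[j ->]]; apply: computable_proj.
by move=> F /HPhi; apply: computable_load.
Qed.

Definition emb x := c 0 (c 0 (c x 0)).
Definition unemb v := c1 (c2 (c2 v)).

Hypothesis Qcomputable : forall F, Q F -> computable (tagged F).

(** The letters 0, x become f(x), x, then x, f(x) after [swp]; computing the inverse from f(x) into
    the letter x clears it, since [tr x x] is 0. *)
Lemma run_perm f f' : inG f f' -> exists2 h, H h & forall x, h (emb x) = emb (f x).
Proof.
move=> [fK f'K Qf Qf']; have [Hc Hi] := groupH.
have [h Hh hE] := Qcomputable Qf; have [k Hk kE] := Qcomputable Qf'.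
exists (k \o (swp \o h)); first by do 2 (apply: (Hc) => //).
have embE x : emb x = st 0 [:: 0, x & [tuple]] by [].
move=> x /=; rewrite !embE.
rewrite (hE 0 0 [tuple x]) swp_st (kE 0 x [tuple f x]) /= /tnth /= fK.
by rewrite /tr; case: eqP => [->|_]; rewrite ?eqxx.
Qed.

End Machine.

(** * Finite generation *)

Lemma embK : cancel emb unemb.
Proof. by move=> x; rewrite /unemb /emb !(cK1, cK2). Qed.

Lemma q1_emb : q1 emb. Proof. by rewrite /emb; qc. Qed.
Lemma q1_unemb : q1 unemb. Proof. by rewrite /unemb; qc. Qed.

(** Only the action of [h] from the range of [e] to that of [d] matters, because [hat] is trivial
    off these ranges. *)
Lemma hat_conj e e' d d' h h' p p' w : cancel e e' -> cancel d d' ->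
  inG h h' -> inG p p' -> (forall x, h (e x) = d (p x)) ->
  hat d d' (p \o w \o p') = h \o hat e e' w \o h'.
Proof.
move=> eK dK [hK h'K _ _] [pK p'K _ _] hE; apply/funext => v; rewrite /hat /=.
have h'E x : h' (d x) = e (p' x) by rewrite -[in LHS](p'K x) -hE hK.
case: (boolP (_ == v)) => [/eqP <-|nv]; first by rewrite h'E !eK eqxx hE dK.
case: (boolP (_ == h' v)) => [/eqP Ev|_]; last by rewrite h'K.
by move: nv; rewrite -[v]h'K -Ev hE dK eqxx.
Qed.

(** The machine yields all permutations supported on clean states. As [t j] carries everything
    outside column [j] to clean states, the three disjoint columns 0, 1, 2 serve in
    [generation_by_classes]. *)
Lemma machine_generation Phi (H : set (nat -> nat)) (t : nat -> nat -> nat) :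
  has_regular_separation Q -> superposition_closure Phi = Q -> fgroup H ->
  H rot -> H swp -> H (load (fun x : 1.-tuple nat => tnth x ord0)) ->
  (forall F, Phi F -> H (load (tagged F))) ->
  H (hat emb unemb W1) -> H (hat emb unemb W2) ->
  (forall j, j < 3 -> H (t j) /\
     forall v, (emb (unemb (t j v)) == t j v) = (c2 v != j)) ->
  Gr Q `<=` H.
Proof.
move=> sep PhiQ gH Hrot Hswp Hcopy HPhi HW1 HW2 Ht; have [Hc Hi] := gH.
have Qcomp F : Q F -> computable H (tagged F).
  by rewrite -PhiQ; apply: computable_closure.
have Hhat : Gr Q `<=` [set f | H (hat emb unemb f)].
  apply: commutator_generation => // [f g Hf Hg|p p' g g' W Gp Gg HW] /=.
    by rewrite hat_comp; [exact: Hc | exact: embK].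
  have {HW} HW : H (hat emb unemb W) by case: HW => ->.
  have conj k k' : inG k k' -> H (hat emb unemb (k \o W \o k')).
    move=> Gk; have [h Hh hE] := run_perm gH Hswp Qcomp Gk.
    have [h' Hh' Gh] := Hi _ Hh.
    by rewrite (hat_conj _ embK embK Gh Gk) //; apply: (Hc _ _ (Hc _ _ _ _)).
  have [pK _ _ _] := Gp.
  have -> : p \o (slot0 g \o W \o slot0 g' \o W) \o p' =
      ((p \o slot0 g) \o W \o (slot0 g' \o p')) \o (p \o W \o p').
    by apply/funext => x /=; rewrite pK.
  rewrite hat_comp; last exact: embK.
  by apply: Hc; apply: conj => //; apply: inG_comp => //; apply: inG_slot0.
have symE := symin_range q1_emb q1_unemb embK Hhat.
apply: (@generation_by_classes (fun j v => c2 v == j)) =>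
  // [j j3|i j v _ _ /eqP-> /eqP//].
split; first by qc.
have [Htj tjE] := Ht j j3.
by apply: (symin_transport gH Htj _ symE) => v nv; rewrite tjE.
Qed.

Lemma finitely_generated : has_regular_separation Q -> has_finite_basis Q ->
  exists S : seq (nat -> nat), Gr Q `<=` compositions [set` S] /\
    forall s, s \in S -> Gr Q s.
Proof.
move=> sep [Phi [finPhi PhiQ]].
have rE : reg (fun v => emb (unemb v) == v).
  exact: (reg_range q1_emb q1_unemb embK).
have rnE : reg (fun v => emb (unemb v) != v).
  (* States whose left stack is 1 are never clean, so the complement of the clean states contains a
     regular set. *)
  have Qe : q1 (fun x => c 1 x) by qc.
  have eK : cancel (fun x => c 1 x) c2 by move=> x; rewrite cK2.
  apply: (reg_super (reg_range Qe Qc2 eK)) => [|v /eqP<-].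
    by have := q1_emb; have := q1_unemb => ? ?; qc.
  by apply/eqP => /(congr1 c1); rewrite /emb !cK1.
have Ht j : exists tt' : (nat -> nat) * (nat -> nat), inG tt'.1 tt'.2 /\
    forall v, (emb (unemb (tt'.1 v)) == tt'.1 v) = (c2 v != j).
  have [|t [t' [Gt Et]]] := reg_perm (reg_cocolumn j) _ rE rnE.
    by apply: reg_ext (reg_column j) => v; rewrite negbK.
  by exists (t, t').
have {Ht} [t Ht] := choice Ht.
have [L LE] : exists L : seq (nat -> nat), [set load (tagged F) | F in Phi] = [set` L].
  exact/finite_seqP/finite_image.
have Qload F : Phi F -> Q (pack (tagged F)).
  by case: F => n f PF; rewrite -PhiQ; apply: (@sub_gen_smallest _ superposition_closed Phi).
pose copy := load (fun x : 1.-tuple nat => tnth x ord0).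
have Gcopy : inG copy copy by apply: inG_load; apply: q1_id.
pose W k := hat emb unemb (if k == 1 then W1 else W2).
have GW k : inG (W k) (W k).
  apply: (inG_hat q1_emb q1_unemb embK); case: eqP => _.
    exact: inG_invol q1_W1 W1K.
  exact: inG_invol q1_W2 W2K.
pose S := [:: rot, unrot, swp, copy, W 1, W 2, (t 0).1, (t 0).2, (t 1).1, (t 1).2,
  (t 2).1, (t 2).2 & L].
have invS s : s \in S -> exists2 s', s' \in S & inG s s'.
  rewrite !inE => /orP[/eqP->|/orP[/eqP->|/orP[/eqP->|
    /orP[/eqP->|/orP[/eqP->|/orP[/eqP->|
    /orP[/eqP->|/orP[/eqP->|/orP[/eqP->|
    /orP[/eqP->|/orP[/eqP->|/orP[/eqP->|
    sL]]]]]]]]]]]].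
  - by exists unrot; [rewrite !inE eqxx ?orbT | exact: inG_rot].
  - by exists rot; [rewrite !inE eqxx ?orbT | exact: inG_sym inG_rot].
  - by exists swp; [rewrite !inE eqxx ?orbT | exact: inG_swp].
  - by exists copy; [rewrite !inE eqxx ?orbT | exact: Gcopy].
  - by exists (W 1); [rewrite !inE eqxx ?orbT | exact: GW].
  - by exists (W 2); [rewrite !inE eqxx ?orbT | exact: GW].
  - by exists (t 0).2; [rewrite !inE eqxx ?orbT | have [] := Ht 0].
  - by exists (t 0).1; [rewrite !inE eqxx ?orbT | have [/inG_sym] := Ht 0].
  - by exists (t 1).2; [rewrite !inE eqxx ?orbT | have [] := Ht 1].
  - by exists (t 1).1; [rewrite !inE eqxx ?orbT | have [/inG_sym] := Ht 1].
  - by exists (t 2).2; [rewrite !inE eqxx ?orbT | have [] := Ht 2].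
  - by exists (t 2).1; [rewrite !inE eqxx ?orbT | have [/inG_sym] := Ht 2].
  exists s; first by rewrite !inE sL !orbT.
  have : [set` L] s by []; rewrite -LE => -[F PF <-].
  exact: inG_load (Qload F PF).
exists S; split=> [|s /invS[s' _ Gs]]; last by exists s'.
have HS s : s \in S -> compositions [set` S] s by move=> sS; apply: sub_gen_smallest.
apply: (@machine_generation Phi _ (fun j => (t j).1)) => //;
  try by apply: HS; rewrite !inE eqxx ?orbT.
- by apply: fgroup_compositions => s /invS[s' /HS]; exists s'.
- move=> F PF; apply: HS; rewrite !inE.
  suff -> : load (tagged F) \in L by rewrite !orbT.
  by have : [set` L] (load (tagged F)) by rewrite -LE; exists F.
- move=> j j3; split; last by have [] := Ht j.
  by case: j j3 => [|[|[|//]]] _; apply: HS; rewrite !inE eqxx ?orbT.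
Qed.

(** * Two generators *)

(** A single permutation involves finitely many braid pairs, so a finite list does too. *)
Lemma braid_list (S : seq (nat -> nat)) : has_regular_separation Q ->
  (forall s, s \in S -> Gr Q s) ->
  exists L : seq ((nat -> nat) * (nat -> nat)),
    (forall pq, pq \in L -> braid pq.1 pq.2) /\
    forall s, s \in S -> compositions [set pq.1 \o pq.2 | pq in [set` L]] s.
Proof.
move=> sep GS; pose gen (L : seq ((nat -> nat) * (nat -> nat))) :=
  compositions [set pq.1 \o pq.2 | pq in [set` L]].
have gen_sub L1 L2 : {subset L1 <= L2} -> gen L1 `<=` gen L2.
  move=> L12; apply: smallest_sub => [f g|_ [pq pqL <-]].
    exact: compositions_comp.
  by apply: sub_gen_smallest; exists pq => //; apply: L12.
pose K := [set f | exists2 L, forall pq, pq \in L -> braid pq.1 pq.2 & gen L f].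
have GK : Gr Q `<=` K.
  apply: braid_generation => // [f g [L1 b1 g1] [L2 b2 g2]|p q bpq].
    exists (L1 ++ L2) => [pq|]; first by rewrite mem_cat => /orP[/b1|/b2].
    apply: compositions_comp.
      by apply: gen_sub g1 => x; rewrite mem_cat => ->.
    by apply: gen_sub g2 => x; rewrite mem_cat => ->; rewrite orbT.
  exists [:: (p, q)] => [pq|]; first by rewrite inE => /eqP->.
  by apply: sub_gen_smallest; exists (p, q) => //=; rewrite inE.
elim: S GS => [|s S IH] GS; first by exists [::].
have [|L1 [b1 g1]] := IH; first by move=> t tS; apply: GS; rewrite inE tS orbT.
have [|L2 b2 g2] := GK s; first by apply: GS; rewrite inE eqxx.
exists (L2 ++ L1); split=> [pq|t]; first by rewrite mem_cat => /orP[/b2|/b1].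
rewrite inE => /orP[/eqP->|/g1 g1t].
  by apply: gen_sub g2 => x; rewrite mem_cat => ->.
by apply: gen_sub g1t => x; rewrite mem_cat => ->; rewrite orbT.
Qed.

(* N split into the B + 1 blocks of the points c x k with k = 0, ..., B - 1,
   and k >= B. *)
Definition mkb B k x := if k < B then c x k else c (c1 x) (c2 x + B).
Definition blk B v := if c2 v < B then c2 v else B.
Definition idx B v := if c2 v < B then c1 v else c (c1 v) (c2 v - B).

Lemma blk_le B v : blk B v <= B.
Proof. by rewrite /blk; case: ltnP => // /ltnW. Qed.

Lemma blk_mkb B k x : k <= B -> blk B (mkb B k x) = k.
Proof.
rewrite /blk /mkb => kB; case: (ltnP k B) => kB'; rewrite cK2 ?kB' //.
by rewrite ltnNge leq_addl /=; lia.
Qed.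

Lemma idx_mkb B k x : k <= B -> idx B (mkb B k x) = x.
Proof.
rewrite /idx /mkb => kB; case: (ltnP k B) => kB'; rewrite !cK2 ?cK1 ?kB' //.
by rewrite ltnNge leq_addl /= addnK cK.
Qed.

Lemma mkbK B v : mkb B (blk B v) (idx B v) = v.
Proof.
rewrite /mkb /blk /idx; case: (ltnP (c2 v) B) => [->|le]; first exact: cK.
by rewrite ltnn cK1 cK2 subnK // cK.
Qed.

Lemma mkb_ind B (P : nat -> Prop) : (forall k x, k <= B -> P (mkb B k x)) -> forall v, P v.
Proof. by move=> H v; rewrite -(mkbK B v); apply: H; apply: blk_le. Qed.

Lemma q1_mkb B f g : q1 f -> q1 g -> q1 (fun v => mkb B (f v) (g v)).
Proof. by move=> Qf Qg; rewrite /mkb; qc. Qed.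

Lemma q1_blk B : q1 (blk B). Proof. by rewrite /blk; qc. Qed.
Lemma q1_idx B : q1 (idx B). Proof. by rewrite /idx; qc. Qed.

(** * The cyclic shift of blocks and the involution acting on them *)

Section Blocks.

Variable B : nat.
Hypothesis B_gt : 5 < B.

Let Qblk : q1 (blk B) := q1_blk B.
Let Qidx : q1 (idx B) := q1_idx B.

Ltac qb :=
  try rewrite /dq; cbv beta;
  lazymatch goal with
  | |- q1 (fun v => mkb _ (@?f v) (@?g v)) => apply: (@q1_mkb _ f g); qb
  | |- q1 (fun v => ?u (@?f v)) => first [qc | apply: q1_if; qb]
  | |- _ => first [qc | apply: q1_if; qb]
  end.

Definition shift v := mkb B (if blk B v == B then 0 else (blk B v).+1) (idx B v).

Lemma shift_iter j k x : k <= B -> iter j shift (mkb B k x) = mkb B ((k + j) %% B.+1) x.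
Proof.
move=> kB; elim: j => [|j IH]; first by rewrite addn0 modn_small.
have lt : (k + j) %% B.+1 < B.+1 by rewrite ltn_mod.
rewrite iterS IH /shift blk_mkb ?idx_mkb //; congr mkb.
have -> : (k + j.+1) %% B.+1 = ((k + j) %% B.+1).+1 %% B.+1.
  by rewrite addnS -addn1 -modnDml addn1.
move: (_ %% _) lt => r lt; case: eqP => [->|ne]; first by rewrite modnn.
by rewrite modn_small //; lia.
Qed.

Lemma shift_period : iter B.+1 shift = id.
Proof.
apply/funext; apply: (@mkb_ind B) => k x kB.
by rewrite shift_iter // modnDr modn_small.
Qed.

Lemma iter_q1 n f : q1 f -> q1 (iter n f).
Proof. by move=> Qf; elim: n => [|n IH]; [exact: q1_id | exact: q1_comp Qf IH]. Qed.

Lemma inG_shift_iter i j n : i + j = n * B.+1 -> inG (iter i shift) (iter j shift).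
Proof.
have Qs : q1 shift by rewrite /shift; qb.
have K k l : k + l = n * B.+1 -> cancel (iter k shift) (iter l shift).
  move=> E v; rewrite -iterD addnC E; elim: n {E} => // n IH.
  by rewrite mulSn iterD IH shift_period.
by move=> E; split; try exact: iter_q1; apply: K; rewrite // addnC.
Qed.

(* Exchanges block 1 with the union of the blocks 2, 3, 4. *)
Definition theta v :=
  if blk B v == 1 then mkb B (blk 2 (idx B v)).+2 (idx 2 (idx B v))
  else if (1 < blk B v) && (blk B v < 5) then mkb B 1 (mkb 2 (blk B v).-2 (idx B v))
  else v.

Lemma thetaK : involutive theta.
Proof.
have B1 : 1 <= B by lia.
apply: (@mkb_ind B) => k x kB; rewrite /theta blk_mkb // idx_mkb //.
case: (eqVneq k 1) => [->|k1].
  have l2 := blk_le 2 x; rewrite blk_mkb ?idx_mkb; [|lia|lia].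
  by rewrite /= !ltnS l2 mkbK.
case: (boolP (_ && _)) => [/andP[k2 k5]|/negbTE k25].
  by rewrite blk_mkb // idx_mkb // eqxx blk_mkb ?idx_mkb; [congr mkb; lia | lia | lia].
by rewrite blk_mkb // k25 (negbTE k1).
Qed.

Lemma q1_theta : q1 theta.
Proof. by have := q1_blk 2; have := q1_idx 2 => ? ?; rewrite /theta; qb. Qed.

Variable fam : nat -> nat -> nat.
Hypothesis Qfam : forall k, q1 (fam k).
Hypothesis famK : forall k, involutive (fam k).
Variable pos : nat -> bool.
Hypothesis fam_pos : forall k, ~~ pos k -> fam k = id.
Hypothesis pos_gt : forall k, pos k -> 4 < k.

Definition occ k := (0 < k) && (k < 5) || pos k.

(** The blocks that [mix] may move lie in the first half of the cycle, so congruent differences of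
    such blocks modulo [B.+1] are equal. By [golomb], the difference d - e then occurs only with [d]
    as its first member. *)
Hypothesis occ_lt : forall k, occ k -> k + k < B.+1.
Hypothesis golomb : forall d e x y, pos d -> pos e -> d <> e ->
  occ x -> occ y -> x + e = y + d -> x = d.

Definition mix v :=
  if (0 < blk B v) && (blk B v < 5) then theta v
  else mkb B (blk B v) (fam (blk B v) (idx B v)).

Lemma q1_mix : q1 mix.
Proof.
have Qf := @q1_family B.+1 fam (blk B) (idx B) Qfam Qblk Qidx (blk_le B).
rewrite /mix; apply: q1_if; [by qc | exact: q1_theta | exact: q1_mkb].
Qed.

Lemma mix_mkb k x : k <= B -> ~~ ((0 < k) && (k < 5)) ->
  mix (mkb B k x) = mkb B k (fam k x).
Proof. by move=> kB /negbTE nk; rewrite /mix blk_mkb // idx_mkb // nk. Qed.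

Lemma mix_theta v : (0 < blk B v) && (blk B v < 5) -> mix v = theta v.
Proof. by rewrite /mix => ->. Qed.

Lemma blk_theta v : (0 < blk B v) && (blk B v < 5) ->
  blk B (theta v) = if blk B v == 1 then (blk 2 (idx B v)).+2 else 1.
Proof.
move=> /andP[v0 v5]; have l2 := blk_le 2 (idx B v); rewrite /theta.
case: (eqVneq (blk B v) 1) => [_|v1]; first by rewrite blk_mkb //; lia.
by rewrite v5 ltn_neqAle eq_sym v1 v0 /= blk_mkb //; lia.
Qed.

Lemma mixK : involutive mix.
Proof.
move=> v; case: (boolP ((0 < blk B v) && (blk B v < 5))) => [v5|].
  rewrite (mix_theta v5) mix_theta ?thetaK // blk_theta //.
  by have l2 := blk_le 2 (idx B v); case: eqP => _; lia.
elim/(@mkb_ind B): v => k x kB; rewrite blk_mkb // => nk.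
by rewrite !mix_mkb // famK.
Qed.

Lemma mix_occ k x : k <= B -> ~~ occ k -> mix (mkb B k x) = mkb B k x.
Proof.
by move=> kB /norP[nk /fam_pos fk]; rewrite mix_mkb // fk.
Qed.

Lemma pos_big k : pos k -> ~~ ((0 < k) && (k < 5)).
Proof. by move/pos_gt => k4; apply/negP => /andP[_]; lia. Qed.

(** Off [D] the involutions have disjoint supports, hence commute. *)
Lemma commutator_outside f g (D : nat -> bool) : involutive f -> involutive g ->
  (forall v, D v -> D (f v)) -> (forall v, D v -> D (g v)) ->
  (forall v, ~~ D v -> f v = v \/ g v = v) ->
  forall v, ~~ D v -> f (g (f (g v))) = v.
Proof.
move=> fK gK fD gD fg v nv.
have nfv : ~~ D (f v) by apply: contra nv => /fD; rewrite fK.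
have ngv : ~~ D (g v) by apply: contra nv => /gD; rewrite gK.
case: (fg v nv) => E.
  case: (fg _ ngv) => E'; first by rewrite E' gK.
  by move: E'; rewrite gK => E'; rewrite -!E' E -E'.
rewrite E; case: (fg _ nfv) => E'; last by rewrite E' fK.
by move: E'; rewrite fK => E'; rewrite -E' E -E'.
Qed.

(** The conjugate of [mix] by the shift from block [e] to block [d] acts on block [d] as [fam e].
    Any other block moved by both involutions would give a second pair of occupied blocks with
    difference d - e. *)
Lemma block_commutator d e : pos d -> pos e -> d <> e ->
  exists i j, i + j = 2 * B.+1 /\
    hat (mkb B d) (idx B) (fam d \o fam e \o fam d \o fam e) =
    mix \o (iter i shift \o mix \o iter j shift) \o
    (mix \o (iter i shift \o mix \o iter j shift)).
Proof.
move=> pd pe de.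
have d2 : d + d < B.+1 by apply: occ_lt; rewrite /occ pd orbT.
have e2 : e + e < B.+1 by apply: occ_lt; rewrite /occ pe orbT.
have [dB eB] : d <= B /\ e <= B by lia.
(* Nonnegative representatives of d - e and e - d modulo [B.+1]. *)
pose i := d + (B.+1 - e); pose j := e + (B.+1 - d).
have ij : i + j = 2 * B.+1 by rewrite /i /j; lia.
exists i, j; split=> //; have [ijK jiK _ _] := inG_shift_iter ij.
set g := iter i shift \o mix \o iter j shift.
have gE k x : k <= B -> g (mkb B k x) = iter i shift (mix (mkb B ((k + j) %% B.+1) x)).
  by move=> kB; rewrite /g /= shift_iter.
have modB k : k %% B.+1 <= B by rewrite -ltnS ltn_mod.
have gK : involutive g by move=> v; rewrite /g /= ijK mixK jiK.
have gD x : g (mkb B d x) = mkb B d (fam e x).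
  have -> : mkb B d x = iter i shift (mkb B e x).
    by rewrite shift_iter // (_ : e + i = d + B.+1) ?modnDr ?modn_small /i; lia.
  rewrite /g /= ijK mix_mkb ?pos_big // shift_iter //.
  by rewrite (_ : e + i = d + B.+1) ?modnDr ?modn_small /i; lia.
have gfix k x : k <= B -> ~~ occ ((k + j) %% B.+1) -> g (mkb B k x) = mkb B k x.
  by move=> kB nk; rewrite gE // mix_occ // -shift_iter // jiK.
have fD x : mix (mkb B d x) = mkb B d (fam d x) by rewrite mix_mkb // pos_big.
apply/funext => v; rewrite /hat [RHS]/=; case: (boolP (_ == v)) => [/eqP <-|nv].
  by rewrite idx_mkb // gD fD gD fD.
have {}nv : blk B v != d by apply: contra nv => /eqP <-; rewrite mkbK.
rewrite (@commutator_outside mix g (fun v => blk B v == d)) //; first exact: mixK.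
- by elim/(@mkb_ind B) => k x kB; rewrite blk_mkb // => /eqP->; rewrite fD blk_mkb.
- by elim/(@mkb_ind B) => k x kB; rewrite blk_mkb // => /eqP->; rewrite gD blk_mkb.
elim/(@mkb_ind B) => k x kB; rewrite blk_mkb // => kd.
case: (boolP (occ k)) => [ok|nk]; last by left; apply: mix_occ.
right; apply: gfix => //; apply/negP => ok'.
have k2 := occ_lt ok; have k2' := occ_lt ok'.
suff E : k + e = (k + j) %% B.+1 + d.
  by move: kd; rewrite (golomb pd pe de ok ok' E) eqxx.
move: k2'; rewrite /j; case: (ltnP (k + e) d) => ked.
  by rewrite modn_small; lia.
rewrite (_ : k + _ = (k + e - d) + B.+1) ?modnDr ?modn_small; lia.
Qed.

Lemma mkb_eq k v : k <= B -> (mkb B k (idx B v) == v) = (blk B v == k).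
Proof.
move=> kB; apply/eqP/eqP => [<-|<-]; first by rewrite blk_mkb.
exact: mkbK.
Qed.

(* Squeezes the blocks k and k + 1 into block k, spreading block k + 2. *)
Definition squeeze k v :=
  if blk B v == k then mkb B k (idx B v + idx B v)
  else if blk B v == k.+1 then mkb B k (idx B v + idx B v).+1
  else if blk B v == k.+2 then
    (if odd (idx B v) then mkb B k.+2 (idx B v)./2 else mkb B k.+1 (idx B v)./2)
  else v.

Definition unsqueeze k v :=
  if blk B v == k then
    (if odd (idx B v) then mkb B k.+1 (idx B v)./2 else mkb B k (idx B v)./2)
  else if blk B v == k.+1 then mkb B k.+2 (idx B v + idx B v)
  else if blk B v == k.+2 then mkb B k.+2 (idx B v + idx B v).+1
  else v.

Lemma inG_squeeze k : k.+2 <= B -> inG (squeeze k) (unsqueeze k).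
Proof.
move=> kB; have kB0 : k <= B by lia.
have kB1 : k.+1 <= B by lia.
have n10 : (k.+1 == k) = false by lia.
have n20 : (k.+2 == k) = false by lia.
have n21 : (k.+2 == k.+1) = false by lia.
have even_double x : odd (x + x) = false by rewrite addnn odd_double.
have half_double x : (x + x)./2 = x by rewrite addnn doubleK.
have half_succ x : (x + x).+1./2 = x by rewrite addnn /= uphalf_double.
have even_half x : odd x = false -> x./2 + x./2 = x.
  by move=> ox; rewrite addnn -[RHS](odd_double_half x) ox.
have odd_half x : odd x = true -> (x./2 + x./2).+1 = x.
  by move=> ox; rewrite addnn -[RHS](odd_double_half x) ox.
pose E := (blk_mkb, idx_mkb, n10, n20, n21, eqxx, even_double, half_double, half_succ).
split; [| | by rewrite /squeeze; qb | by rewrite /unsqueeze; qb].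
- elim/(@mkb_ind B) => l x lB; rewrite /squeeze /unsqueeze !E //.
  case: (eqVneq l k) => [->|l0]; first by rewrite !E.
  case: (eqVneq l k.+1) => [->|l1]; first by rewrite !E //= even_double.
  case: (eqVneq l k.+2) => [->|l2].
    by case Ox: (odd x); rewrite !E //; [rewrite odd_half | rewrite even_half].
  by rewrite !E // (negbTE l0) (negbTE l1) (negbTE l2).
- elim/(@mkb_ind B) => l x lB; rewrite /squeeze /unsqueeze !E //.
  case: (eqVneq l k) => [->|l0].
    by case Ox: (odd x); rewrite !E //; [rewrite odd_half | rewrite even_half].
  case: (eqVneq l k.+1) => [->|l1]; first by rewrite !E.
  case: (eqVneq l k.+2) => [->|l2]; first by rewrite !E //= even_double.
  by rewrite !E // (negbTE l0) (negbTE l1) (negbTE l2).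
Qed.

(** From block 1, [theta] gives the blocks 2, 3, 4 together, and the shift any three consecutive
    blocks k, k + 1, k + 2 with k > 0. These contain the support of [squeeze k], which folds one
    more block into those already covered; so all blocks but 0 and [B] are reached together. *)
Lemma two_generation (H : set (nat -> nat)) : has_regular_separation Q ->
  fgroup H -> H shift -> H mix ->
  (forall f, Gr Q f -> H (hat (mkb B 1) (idx B) f)) -> Gr Q `<=` H.
Proof.
move=> sep gH Hshift Hmix Hhat; have [Hc Hi] := gH.
have B1 : 1 <= B by lia.
have Hiter n : H (iter n shift).
  by elim: n => [|n IH]; [exact: fgroup_id gH Hshift | exact: Hc Hshift IH].
have sym1 : symin (fun v => blk B v == 1) H.
  have Qe : q1 (mkb B 1) by apply: (@q1_mkb B (fun=> 1) id (q1_cst 1) q1_id).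
  have eK : cancel (mkb B 1) (idx B) by move=> x; rewrite idx_mkb.
  apply: symin_sub (symin_range Qe Qidx eK Hhat) => v.
  by rewrite mkb_eq.
have sym234 : symin (fun v => (1 < blk B v) && (blk B v < 5)) H.
  apply: (symin_transport gH Hmix _ sym1) => v /andP[v1 v5].
  have v05 : (0 < blk B v) && (blk B v < 5) by rewrite v5 ltnW.
  by rewrite (mix_theta v05) (blk_theta v05) (gtn_eqF v1).
have sym3 k : 0 < k -> k.+2 <= B -> symin (fun v => (k <= blk B v) && (blk B v <= k.+2)) H.
  move=> k0 kB; apply: (symin_transport gH (Hiter (B.+3 - k)) _ sym234).
  elim/(@mkb_ind B) => l x lB; rewrite blk_mkb // => /andP[kl lk].
  rewrite shift_iter // (_ : l + _ = (l + 2 - k) + B.+1); last by lia.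
  rewrite modnDr modn_small; last by lia.
  by rewrite blk_mkb; lia.
have symX n : 0 < n -> n < B -> symin (fun v => (0 < blk B v) && (blk B v <= n)) H.
  elim: n => // n IH _ nB; case: (posnP n) => [->|n0].
    by apply: symin_sub sym1 => v; lia.
  have Gs : inG (squeeze n) (unsqueeze n) by apply: inG_squeeze.
  have Hs : H (squeeze n).
    apply: (sym3 n n0 nB _ _ Gs) => v nv; rewrite /squeeze.
    by do 3 (case: eqP => [?|_]; first by lia).
  apply: (symin_transport gH Hs _ (IH n0 (ltnW nB))).
  elim/(@mkb_ind B) => l x lB; rewrite blk_mkb // => /andP[l0 ln].
  rewrite /squeeze blk_mkb //; case: (eqVneq l n) => [_|n1]; first by rewrite blk_mkb; lia.
  case: (eqVneq l n.+1) => [_|n2]; first by rewrite blk_mkb; lia.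
  by have -> : (l == n.+2) = false; [lia | rewrite blk_mkb; lia].
apply: (@generation_by_classes (fun j v => (blk B v)./2 == j)) =>
  // [j j3|i j v _ _ /eqP-> /eqP//].
split; first by qc.
(* This power of the shift sends the blocks 2j and 2j + 1 to the two missing blocks [B] and 0. *)
have symB := symX B.-1; apply: (symin_transport gH (Hiter (B.+1 - j.*2.+1)) _ (symB _ _)).
- elim/(@mkb_ind B) => l x lB; rewrite blk_mkb // => lj.
  have [lt|ge] := ltnP l j.*2.
    rewrite shift_iter // modn_small; last by lia.
    by rewrite blk_mkb; lia.
  rewrite shift_iter // (_ : l + _ = (l - j.*2.+1) + B.+1); last by lia.
  rewrite modnDr modn_small; last by lia.
  by rewrite blk_mkb; lia.
- by lia.
- by lia.
Qed.

Lemma shift_mix_generation : has_regular_separation Q ->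
  (forall K : set (nat -> nat), (forall f g, K f -> K g -> K (f \o g)) ->
    (forall d e, pos d -> pos e -> d <> e -> K (fam d \o fam e \o fam d \o fam e)) ->
    Gr Q `<=` K) ->
  [/\ Gr Q shift, Gr Q mix & Gr Q `<=` compositions [set shift; mix]].
Proof.
move=> sep gen.
have Gmix : inG mix mix by apply: inG_invol; [exact: q1_mix | exact: mixK].
have Gshift : inG shift (iter B shift).
  by apply: (@inG_shift_iter 1 B 1); rewrite mul1n add1n.
split; [by exists (iter B shift) | by exists mix |].
set H := compositions _.
have Hs : H shift by apply: sub_gen_smallest; left.
have Hm : H mix by apply: sub_gen_smallest; right.
have Hc f g : H f -> H g -> H (f \o g) by apply: compositions_comp.
have gH : fgroup H.
  apply: fgroup_compositions => s [->|->]; last by exists mix.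
  exists (iter B shift) => //; have : 0 < B by lia.
  elim: (B) => // n IH _; case: (posnP n) => [->//|n0].
  exact: Hc Hs (IH n0).
have Hiter n : H (iter n shift).
  by elim: n => [|n IH]; [exact: fgroup_id gH Hs | exact: Hc Hs IH].
have B1 : 1 <= B by lia.
have eK k : k <= B -> cancel (mkb B k) (idx B) by move=> kB x; rewrite idx_mkb.
apply: two_generation => //; apply: gen => [f g Hf Hg|d e pd pe de] /=.
  by rewrite hat_comp; [exact: Hc | exact: eK].
have dB : d <= B.
  have : d + d < B.+1 by apply: occ_lt; rewrite /occ pd orbT.
  by lia.
have [i [j [ij E]]] := block_commutator pd pe de.
have Hcom : H (hat (mkb B d) (idx B) (fam d \o fam e \o fam d \o fam e)).
  by rewrite E; do 4 (apply: (Hc) => //).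
(* The shift that carries block [d], where the commutator acts, to block 1. *)
have Gij : inG (iter (B.+2 - d) shift) (iter (d + B) shift).
  by apply: (@inG_shift_iter _ _ 2); lia.
have hE x : iter (B.+2 - d) shift (mkb B d x) = mkb B 1 (id x).
  rewrite shift_iter // (_ : d + _ = 1 + B.+1); last by lia.
  by rewrite modnDr modn_small.
have -> := hat_conj (fam d \o fam e \o fam d \o fam e)
  (eK d dB) (eK 1 B1) Gij inG_id hE.
by apply: (Hc) => //; apply: (Hc).
Qed.

End Blocks.
(** The powers involved are multiples of 16, which excludes [x] or [y] below 5. Between powers of 2,
    the equation forces equal pairs of summands, by uniqueness of binary expansions. *)
Lemma golomb_powers a b x y : 3 < a -> 3 < b -> a <> b ->
  (0 < x < 5) \/ (exists2 k, 3 < k & x = 2 ^ k) ->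
  (0 < y < 5) \/ (exists2 k, 3 < k & y = 2 ^ k) ->
  x + 2 ^ b = y + 2 ^ a -> x = 2 ^ a.
Proof.
move=> a3 b3 ab.
have lt2 u v : u < v -> 2 * 2 ^ u <= 2 ^ v by move=> uv; rewrite -expnS leq_pexp2l.
have m16 u : 3 < u -> exists w, 2 ^ u = 16 * w.
  by move=> u3; exists (2 ^ (u - 4)); rewrite -[16]/(2 ^ 4) -expnD subnKC.
have [[wa Ea] [wb Eb]] := (m16 _ a3, m16 _ b3).
have ab2 : 2 ^ a <> 2 ^ b by move/(expnI (isT : 1 < 2)).
case=> [x5|[k k3 ->]]; case=> [y5|[l l3 ->]] E.
- by lia.
- by have [wl El] := m16 _ l3; lia.
- by have [wk Ek] := m16 _ k3; lia.
have dich u v : [\/ 2 * 2 ^ u <= 2 ^ v, 2 * 2 ^ v <= 2 ^ u | 2 ^ u = 2 ^ v].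
  by have [/lt2|/lt2|->] := ltngtP u v; [constructor 1 | constructor 2 | constructor 3].
have pos2 u : 0 < 2 ^ u by rewrite expn_gt0.
move: (pos2 a) (pos2 b) (pos2 k) (pos2 l) (dich k a) (dich k l) (dich l b) (dich a b).
by move=> ? ? ? ? [] ? [] ? [] ? [] ?; lia.
Qed.
Lemma two_generated : has_regular_separation Q -> has_finite_basis Q ->
  exists a b, [/\ Gr Q a, Gr Q b & Gr Q `<=` compositions [set a; b]].
Proof.
move=> sep fin; have [S [genS /(braid_list sep)[L [bL genL]]]] := finitely_generated sep fin.
(* The exponent 2i + t + 4 is assigned to component [t] of the pair number [i] in [L]; exponents
   from 4 on avoid the blocks of [theta]. *)
pose pos k := let a := trunc_log 2 k in
  [&& k == 2 ^ a, 3 < a & a < (size L).*2 + 4].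
pose fam k := if pos k then
    let i := trunc_log 2 k - 4 in
    let pq := nth (id, id) L i./2 in if odd i then pq.2 else pq.1
  else id.
have famG k : inG (fam k) (fam k).
  rewrite /fam; case: ifP => [/and3P[_ k3 kL]|_]; last exact: inG_id.
  have /bL[Gp Gq _] : nth (id, id) L (trunc_log 2 k - 4)./2 \in L.
    by apply: mem_nth; rewrite ltn_half_double ltn_subLR // addnC.
  by move: Gp Gq => [pK _ Qp _] [qK _ Qq _]; case: ifP.
(* Twice any position stays below [B.+1], and even for empty [L] there is room for the blocks of
   [theta]. *)
pose B := (2 ^ ((size L).*2 + 5)).-1.
have B1 : B.+1 = 2 ^ ((size L).*2 + 5) by rewrite prednK // expn_gt0.
have B31 : 31 <= B.
  have : 2 ^ 5 <= B.+1 by rewrite B1 leq_pexp2l // leq_addl.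
  by lia.
have posP k : pos k -> exists2 a, 3 < a & k = 2 ^ a.
  by move=> /and3P[/eqP E a3 _]; exists (trunc_log 2 k); [exact: a3 | exact: E].
have pos4 k : pos k -> 4 < k.
  by move=> /posP[a a3 ->]; have := ltn_expl a (ltnSn 1); lia.
have occP k : occ pos k -> (0 < k < 5) \/ (exists2 a, 3 < a & k = 2 ^ a).
  by case/orP => [|/posP]; [left | right].
exists (shift B), (mix B fam).
apply: (@shift_mix_generation B _ fam _ _ pos) => //.
- exact: leq_trans B31.
- by move=> k; have [] := famG k.
- by move=> k; have [] := famG k.
- by move=> k; rewrite /fam => /negbTE ->.
- move=> k /orP[/andP[_ k5]|/and3P[/eqP E _ kL]]; first by lia.
  by rewrite E addnn -mul2n -expnS B1 ltn_exp2l // addnS ltnS.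
- move=> d e x y /posP[a a3 ->] /posP[b b3 ->] ab /occP Hx /occP Hy.
  by apply: golomb_powers => //; move=> E; apply: ab; rewrite E.
move=> K Kc Kfam f /genS; apply: smallest_sub f => // s /genL.
apply: smallest_sub s => // _ [pq pqL <-].
have [/= [pK _ _ _] [qK _ _ _] bpq] := bL _ pqL.
pose i := index pq L; have iL : i < size L by rewrite index_mem.
have posi t : t < 2 -> pos (2 ^ (i.*2 + t + 4)).
  by move=> t2; rewrite /pos /= trunc_expnK // eqxx; lia.
have famp : fam (2 ^ (i.*2 + 0 + 4)) = pq.1.
  rewrite /fam posi // trunc_expnK // addnK addn0 odd_double doubleK.
  by rewrite nth_index.
have famq : fam (2 ^ (i.*2 + 1 + 4)) = pq.2.
  rewrite /fam posi // trunc_expnK // addnK addn1 /= odd_double uphalf_double.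
  by rewrite nth_index.
(* Taken in this order, the commutator is q p q p, which the braid relation turns into p q. *)
have := Kfam _ _ (posi 1 isT) (posi 0 isT).
rewrite famp famq (_ : pq.2 \o _ \o _ \o _ = pq.1 \o pq.2).
  by apply=> /(expnI (isT : 1 < 2)); lia.
by apply/funext => x /=; rewrite bpq qK.
Qed.

End FunctionClass.

(** * Normalization of the pairing function *)

Lemma superposition_closed_closure Phi :
  superposition_closed (superposition_closure Phi).
Proof.
move=> n m f g Pf Pg P [Pc PhiP]; apply: (Pc) => [|i].
  exact: (Pf P (conj Pc PhiP)).
by case: (Pg i) => [Pgi|]; [left; apply: (Pgi P (conj Pc PhiP)) | right].
Qed.

Theorem theorem5 (Q : set mvfun)
  (QI : contains_basic_functions Q)
  (QII : contains_pairing Q)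
  (QIII : has_regular_separation Q)
  (QV : has_finite_basis Q) :
  exists a b : nat -> nat,
    [/\ Gr Q a, Gr Q b &
        forall f : nat -> nat, Gr Q f -> compositions [set a; b] f].
Proof.
have Qcl : superposition_closed Q.
  by case: QV => Phi [_ <-]; apply: superposition_closed_closure.
have [c [c1 [c2 [[u uK Ku] cK Qc Qc1 Qc2]]]] := QII.
have cK' v : c (c1 v) (c2 v) = v.
  by have /= E := Ku v; rewrite -E !(cK _ _).1 !(cK _ _).2.
(* Composing the pairing with the transposition of 0 and [z] makes the pair of zeros have code 0. *)
pose z := c 0 0.
have Qz : q1 Q (tr z).
  have Qid := q1_id Qcl QI; have Qk := q1_cst Qcl QI.
  by apply: q1_if => //; [exact: dq_eq | apply: q1_if => //; exact: dq_eq].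
apply: (@two_generated Q Qcl QI (fun x y => tr z (c x y))
         (fun v => c1 (tr z v)) (fun v => c2 (tr z v))) => //.
- by move=> x y; rewrite trK; case: (cK x y).
- by move=> x y; rewrite trK; case: (cK x y).
- by move=> v; rewrite cK' trK.
- by rewrite /tr -/z eqxx; case: eqP.
- pose g (i : 'I_1) : nfun 2 := fun x => c (tnth x ord0) (tnth x ord_max).
  have := Qcl _ _ _ g Qz (fun=> or_introl Qc).
  by congr (Q (pack _)); apply/funext => x; rewrite /substitute tnth_mktuple.
- exact: q1_comp Qc1 Qz.
- exact: q1_comp Qc2 Qz.
Qed.
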